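(* Let $p$ be an odd prime, let $G$ be a finitely presented pro-$p$ group with a chosen minimal presentation, and let $P(G;t)$ be the associated Golod-Shafarevich polynomial. Suppose that for some $t_0\in(0,1)$ the value $P(G;t_0)$ is negative. Then $\rho(G)\geq\frac{1}{t_0}$.
   Context: For a finitely generated pro-$p$ group $G$, let $\Omega(G):=\varprojlim_U\mathbb{F}_p[G/U]$, where $U$ runs over the finite index (open) normal subgroups of $G$, let $I_G$ be its augmentation ideal, $c_0(G):=1$, $c_n(G):=\dim_{\mathbb{F}_p}(I_G^n/I_G^{n+1})$ for $n\ge1$, and $\rho(G):=\limsup_{n\to\infty}c_n(G)^{1/n}$. Let $d=d(G):=\dim_{\mathbb{F}_p}H^1(G,\mathbb{F}_p)$ and $r=r(G):=\dim_{\mathbb{F}_p}H^2(G,\mathbb{F}_p)$. A minimal presentation of $G$ is an exact sequence $1\to R\to F\xrightarrow{\varphi}G\to1$ with $F$ a free pro-$p$ group on $d$ generators and $R=\langle\rho_1,\dots,\rho_r\rangle^{\mathrm{Norm}}$ the (closed) normal subgroup of $F$ generated by $r$ elements $\rho_1,\dots,\rho_r$. The depth of $x\in F$, $x\neq1$, is $\omega_F(x):=\max\{n\mid x-1\in I_F^n\}$, where $I_F$ is the augmentation ideal of $\Omega(F)$, and $\omega_F(1):=\infty$. The Golod-Shafarevich polynomial is $P(G;t):=1-dt+\sum_{i=1}^r t^{\omega_F(\rho_i)}$. *)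

(* Defs.v *)
From HB Require Import structures.
From mathcomp Require Import all_boot all_order all_algebra all_fingroup.
From mathcomp Require Import all_classical all_reals all_analysis.
Set Implicit Arguments.
Unset Strict Implicit.
Unset Printing Implicit Defensive.
Import Order.TTheory GRing.Theory Num.Theory.
Local Open Scope classical_set_scope.
Local Open Scope ring_scope.

HB.mixin Record Group_Topological_isTopGroup G of monoid.Group G & Topological G := {
  mulg_continuous : continuous (fun x : G * G => (x.1 * x.2)%g);
  invg_continuous : continuous (fun x : G => x^-1%g)
}.

#[short(type="topGroupType")]
HB.structure Definition TopGroup :=
  {G of monoid.Group G & Topological G & Group_Topological_isTopGroup G}.

Definition normal_subgroup (G : groupType) (N : set G) : Prop :=
  [/\ N 1%g,
      forall x y, N x -> N y -> N (x * y)%g,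
      forall x, N x -> N x^-1%g &
      forall x g, N x -> N (x ^ g)%g].

Definition lcosetg (G : groupType) (U : set G) (g : G) : set G :=
  [set (g * u)%g | u in U].

Record openNormal (G : topGroupType) := OpenNormal {
  openNormal_set :> set G;
  openNormal_open : open openNormal_set;
  openNormal_normal : normal_subgroup openNormal_set;
  openNormal_finite : finite_set (range (lcosetg openNormal_set))
}.

Section Quotient.
Variables (G : topGroupType) (U : openNormal G).

Definition quot : Type := set_type (range (lcosetg U)).

HB.instance Definition _ := Choice.copy quot (set_type (range (lcosetg U))).

Let enumq : seq quot := 
  pmap insub (finmap.enum_fset (fset_set (range (lcosetg U)))).

Let enumq_axiom : Finite.axiom enumq.
Proof.
move=> x; rewrite count_uniq_mem; last first.
  exact/(pmap_sub_uniq)/finmap.fset_uniq.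
rewrite mem_pmap_sub in_fset_set; last exact: openNormal_finite.
by rewrite (valP x).
Qed.

Let pickleq (x : quot) : nat := index x enumq.
Let unpickleq (n : nat) : option quot := onth enumq n.

Let pickleqK : pcancel pickleq unpickleq.
Proof.
move=> x; rewrite /unpickleq /pickleq.
have xe : x \in enumq by rewrite -has_pred1 has_count enumq_axiom.
by rewrite onthE (nth_map x) ?index_mem// nth_index.
Qed.

HB.instance Definition _ := Choice_isCountable.Build quot pickleqK.
HB.instance Definition _ := fintype.isFinite.Build quot enumq_axiom.

Lemma quot_pi_subproof (g : G) : lcosetg U g \in range (lcosetg U).
Proof. by apply/mem_set; exists g. Qed.

Definition quot_pi (g : G) : quot := SigSub (quot_pi_subproof g).

Lemma quot_piP (x : quot) : exists g, x = quot_pi g.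
Proof.
have /set_mem[g _ gx] := valP x.
by exists g; apply/val_inj; rewrite /= -gx.
Qed.

Lemma quot_piE (g h : G) : quot_pi g = quot_pi h <-> openNormal_set U (g^-1 * h)%g.
Proof.
have [U1 UM UV _] := openNormal_normal U; split=> [/(congr1 val)/= gh|Ugh].
  have : lcosetg U h h by exists 1%g => //; rewrite mulg1.
  by rewrite -gh => -[u Uu <-]; rewrite mulKg.
apply/val_inj/seteqP; split=> _ [u Uu <-] /=.
  exists ((g^-1 * h)^-1 * u)%g; first by apply: UM => //; exact: UV.
  by rewrite invgM invgK !mulgA mulgV mul1g.
by exists ((g^-1 * h) * u)%g; [exact: UM | rewrite !mulgA mulgV mul1g].
Qed.

Lemma lcosetgM (g h : G) :
  [set (a * b)%g | a in lcosetg U g & b in lcosetg U h] = lcosetg U (g * h)%g.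
Proof.
have [U1 UM UV UJ] := openNormal_normal U; apply/seteqP; split.
  move=> _ [_ [u Uu <-] [_ [v Uv <-] <-]].
  exists (u ^ h * v)%g; first by apply: UM => //; exact: UJ.
  by rewrite /conjg !mulgA mulgK.
move=> _ [u Uu <-]; exists g; first by exists 1%g => //; rewrite mulg1.
by exists (h * u)%g; [exists u | rewrite mulgA].
Qed.

Lemma lcosetgV (g : G) :
  [set (a^-1)%g | a in lcosetg U g] = lcosetg U (g^-1)%g.
Proof.
have [U1 UM UV UJ] := openNormal_normal U; apply/seteqP; split.
  move=> _ [_ [u Uu <-] <-]; exists ((u^-1) ^ (g^-1))%g.
    exact/UJ/UV.
  by rewrite /conjg invgK invgM !mulgA mulVg mul1g.
move=> _ [u Uu <-]; exists (u^-1 * g)%g; last by rewrite invgM invgK.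
exists ((u^-1) ^ g)%g; first exact/UJ/UV.
by rewrite /conjg !mulgA mulgV mul1g.
Qed.

Lemma quot_mul_subproof (x y : quot) :
  [set (a * b)%g | a in val x & b in val y] \in range (lcosetg U).
Proof.
have [g ->] := quot_piP x; have [h ->] := quot_piP y.
by apply/mem_set; exists (g * h)%g => //=; rewrite lcosetgM.
Qed.

Lemma quot_inv_subproof (x : quot) :
  [set (a^-1)%g | a in val x] \in range (lcosetg U).
Proof.
have [g ->] := quot_piP x.
by apply/mem_set; exists (g^-1)%g => //=; rewrite lcosetgV.
Qed.

Definition quot_mul (x y : quot) : quot := SigSub (quot_mul_subproof x y).
Definition quot_inv (x : quot) : quot := SigSub (quot_inv_subproof x).

Lemma quot_piM (g h : G) :
  quot_pi (g * h)%g = quot_mul (quot_pi g) (quot_pi h).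
Proof. by apply/val_inj; rewrite /= lcosetgM. Qed.

Lemma quot_piV (g : G) : quot_pi (g^-1)%g = quot_inv (quot_pi g).
Proof. by apply/val_inj; rewrite /= lcosetgV. Qed.

Let quot_mulA : associative quot_mul.
Proof.
move=> x y z; have [a ->] := quot_piP x; have [b ->] := quot_piP y.
by have [c ->] := quot_piP z; rewrite -!quot_piM mulgA.
Qed.

Let quot_mul1 : left_id (quot_pi 1%g) quot_mul.
Proof. by move=> x; have [a ->] := quot_piP x; rewrite -quot_piM mul1g. Qed.

Let quot_mulV : left_inverse (quot_pi 1%g) quot_inv quot_mul.
Proof.
by move=> x; have [a ->] := quot_piP x; rewrite -quot_piV -quot_piM mulVg.
Qed.

HB.instance Definition _ :=
  Finite_isGroup.Build quot quot_mulA quot_mul1 quot_mulV.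

End Quotient.

(* The natural map G/U -> G/V; it is only meaningful when U is included in V. *)
Definition quot_map (G : topGroupType) (U V : openNormal G) (x : quot U) :
  quot V := quot_pi V (xget 1%g (val x)).

Lemma quot_map_pi (G : topGroupType) (U V : openNormal G) (g : G) :
  U `<=` V -> quot_map V (quot_pi U g) = quot_pi V g.
Proof.
move=> UV; rewrite /quot_map; apply/quot_piE; case: xgetP => [h _ /= [u Uu <-]|].
  have [_ _ VV _] := openNormal_normal V.
  by rewrite invgM mulgKV; apply/VV/UV.
have [U1 _ _ _] := openNormal_normal U.
by move=> /(_ g); case; exists 1%g => //; rewrite mulg1.
Qed.

Lemma quot_mapM (G : topGroupType) (U V : openNormal G) :
  U `<=` V -> {morph @quot_map G U V : x y / (x * y)%g}.
Proof.
move=> UV x y; have [a ->] := quot_piP x; have [b ->] := quot_piP y.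
have -> : (quot_pi U a * quot_pi U b)%g = quot_pi U (a * b)%g.
  by rewrite quot_piM.
by rewrite !quot_map_pi// quot_piM.
Qed.

Section GroupAlgebra.
Variables (K : fieldType) (Q : finGroupType).

(* The group algebra K[Q]; the alias keeps the convolution product apart from
   the pointwise product of finite functions. *)
Definition galg : Type := {ffun Q -> K}.

HB.instance Definition _ := GRing.Lmodule.copy galg {ffun Q -> K^o}.

Implicit Types a b c : galg.

Definition galg_mul a b : galg := [ffun x : Q => \sum_y a y * b (y^-1 * x)%g].
Definition galg_of (g : Q) : galg := [ffun x : Q => (x == g)%:R].

Let galg_mulA : associative galg_mul.
Proof.
move=> a b c; apply/ffunP=> x; rewrite !ffunE.
under eq_bigr do rewrite ffunE big_distrr /=.
under [RHS]eq_bigr do rewrite ffunE big_distrl /=.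
rewrite [RHS]exchange_big; apply: eq_bigr => y _ /=.
rewrite [RHS](reindex_inj (mulgI y)); apply: eq_bigr => z _ /=.
by rewrite mulrA mulKg invgM !mulgA.
Qed.

Let galg_mul1 : left_id (galg_of 1%g) galg_mul.
Proof.
move=> a; apply/ffunP=> x; rewrite !ffunE (bigD1 1%g)//= ffunE eqxx mul1r.
rewrite invg1 mul1g big1 ?addr0// => y /negbTE y1.
by rewrite ffunE y1 mul0r.
Qed.

Let galg_mulr1 : right_id (galg_of 1%g) galg_mul.
Proof.
move=> a; apply/ffunP=> x; rewrite !ffunE (bigD1 x)//= ffunE mulVg eqxx mulr1.
rewrite big1 ?addr0// => y /negbTE y1.
by rewrite ffunE -eq_invg_mul invgK y1 mulr0.
Qed.

Let galg_mulDl : left_distributive galg_mul +%R.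
Proof.
move=> a b c; apply/ffunP=> x; rewrite !ffunE -big_split /=.
by apply: eq_bigr => y _; rewrite ffunE mulrDl.
Qed.

Let galg_mulDr : right_distributive galg_mul +%R.
Proof.
move=> a b c; apply/ffunP=> x; rewrite !ffunE -big_split /=.
by apply: eq_bigr => y _; rewrite ffunE mulrDr.
Qed.

Let galg_oner_neq0 : galg_of 1%g != 0.
Proof.
by apply/eqP => /ffunP/(_ 1%g); rewrite !ffunE eqxx => /eqP; rewrite oner_eq0.
Qed.

HB.instance Definition _ := GRing.Zmodule_isNzRing.Build galg
  galg_mulA galg_mul1 galg_mulr1 galg_mulDl galg_mulDr galg_oner_neq0.

Let galg_scalerAl (k : K) a b : k *: (a * b) = k *: a * b.
Proof.
apply/ffunP=> x; rewrite !ffunE; rewrite [LHS]big_distrr /=.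
by apply: eq_bigr => y _; rewrite ffunE mulrA.
Qed.

Let galg_scalerAr (k : K) a b : k *: (a * b) = a * (k *: b).
Proof.
apply/ffunP=> x; rewrite !ffunE; rewrite [LHS]big_distrr /=.
by apply: eq_bigr => y _; rewrite ffunE mulrCA.
Qed.

HB.instance Definition _ := GRing.Lmodule_isLalgebra.Build K galg galg_scalerAl.
HB.instance Definition _ := GRing.Lalgebra_isAlgebra.Build K galg galg_scalerAr.

Definition galg_aug a : K := \sum_x a x.

End GroupAlgebra.

(* The linear map K[Q] -> K[Q'] induced by f. *)
Definition galg_map (K : fieldType) (Q Q' : finGroupType) (f : Q -> Q')
  (a : galg K Q) : galg K Q' := [ffun y : Q' => \sum_(x | f x == y) a x].

Section GroupAlgebraMap.
Variables (K : fieldType) (Q Q' : finGroupType) (f : Q -> Q').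

Lemma galg_map_of (g : Q) : galg_map f (galg_of K g) = galg_of K (f g).
Proof.
apply/ffunP=> y; rewrite !ffunE.
under eq_bigr do rewrite ffunE.
have [->|yfg] := eqVneq y (f g).
  by rewrite (bigD1 g)//= eqxx big1 ?addr0// => x /andP[_ /negbTE ->].
rewrite big1// => x /eqP fx; case: eqVneq => // xg.
by rewrite -fx xg eqxx in yfg.
Qed.

Lemma galg_mapD (a b : galg K Q) :
  galg_map f (a + b) = galg_map f a + galg_map f b.
Proof.
apply/ffunP=> y; rewrite !ffunE -big_split.
by apply: eq_bigr => x _; rewrite ffunE.
Qed.

Lemma galg_mapZ (k : K) (a : galg K Q) :
  galg_map f (k *: a) = k *: galg_map f a.
Proof.
apply/ffunP=> y; rewrite !ffunE [RHS]big_distrr.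
by apply: eq_bigr => x _; rewrite ffunE.
Qed.

Lemma galg_map0 : galg_map f (0 : galg K Q) = 0.
Proof. by rewrite -(scale0r (0 : galg K Q)) galg_mapZ scale0r. Qed.

Lemma galg_mapN (a : galg K Q) : galg_map f (- a) = - galg_map f a.
Proof. by rewrite -[in LHS]scaleN1r galg_mapZ scaleN1r. Qed.

Hypothesis fM : {morph f : x y / (x * y)%g}.

Lemma galg_map1 : galg_map f (1 : galg K Q) = 1.
Proof.
have f1 : f 1%g = 1%g.
  by apply: (mulgI (f 1%g)); rewrite -fM !mulg1.
by rewrite [LHS]galg_map_of f1.
Qed.

Lemma galg_mapM (a b : galg K Q) :
  galg_map f (a * b) = galg_map f a * galg_map f b.
Proof.
have fV x : f x^-1%g = (f x)^-1%g.
  apply: (mulgI (f x)); rewrite -fM !mulgV.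
  by apply: (mulgI (f 1%g)); rewrite -fM !mulg1.
apply/ffunP=> y; rewrite !ffunE.
transitivity (\sum_z a z * galg_map f b ((f z)^-1 * y)%g); last first.
  rewrite (partition_big f predT)//=; apply: eq_bigr => u _.
  by rewrite ffunE big_distrl; apply: eq_bigr => z /eqP <-.
under eq_bigr do rewrite ffunE.
rewrite exchange_big; apply: eq_bigr => z _ /=.
rewrite -big_distrr /=; congr (_ * _); rewrite ffunE.
rewrite (reindex_inj (mulgI z)) /=; apply: eq_big => [x|x _].
  by rewrite fM -(inj_eq (mulgI (f z)^-1%g)) mulKg.
by rewrite mulKg.
Qed.

End GroupAlgebraMap.

Section CompletedGroupAlgebra.
Variables (K : fieldType) (G : topGroupType).

Definition compatible (a : forall U : openNormal G, galg K (quot U)) : Prop :=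
  forall U V : openNormal G, U `<=` V -> galg_map (@quot_map G U V) (a U) = a V.

(* The inverse limit of the K[G/U]. *)
Record Omega := MkOmega {
  Omega_comp :> forall U : openNormal G, galg K (quot U);
  Omega_compat : compatible Omega_comp
}.

HB.instance Definition _ := gen_eqMixin Omega.
HB.instance Definition _ := gen_choiceMixin Omega.

Lemma OmegaP (a b : Omega) : (forall U, a U = b U) -> a = b.
Proof.
case: a b => [a ac] [b bc] /= ab.
have {}ab : a = b by exact: functional_extensionality_dep.
by rewrite -ab in bc *; congr MkOmega; exact: Prop_irrelevance.
Qed.

Implicit Types a b c : Omega.

Let add_compat a b : compatible (fun U => a U + b U).
Proof. by move=> U V UV; rewrite galg_mapD !Omega_compat. Qed.

Let opp_compat a : compatible (fun U => - a U).
Proof. by move=> U V UV; rewrite galg_mapN Omega_compat. Qed.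

Let zero_compat : compatible (fun U => 0).
Proof. by move=> U V UV; rewrite galg_map0. Qed.

Let scale_compat (k : K) a : compatible (fun U => k *: a U).
Proof. by move=> U V UV; rewrite galg_mapZ Omega_compat. Qed.

Let mul_compat a b : compatible (fun U => a U * b U).
Proof.
by move=> U V UV; rewrite galg_mapM ?Omega_compat//; exact: quot_mapM.
Qed.

Let of_compat (g : G) : compatible (fun U => galg_of K (quot_pi U g)).
Proof. by move=> U V UV; rewrite galg_map_of quot_map_pi. Qed.

Definition Omega_add a b := MkOmega (add_compat a b).
Definition Omega_opp a := MkOmega (opp_compat a).
Definition Omega_zero := MkOmega zero_compat.
Definition Omega_scale (k : K) a := MkOmega (scale_compat k a).
Definition Omega_mul a b := MkOmega (mul_compat a b).
Definition Omega_of (g : G) := MkOmega (of_compat g).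

Let addA : associative Omega_add.
Proof. by move=> a b c; apply: OmegaP => U /=; rewrite addrA. Qed.
Let addC : commutative Omega_add.
Proof. by move=> a b; apply: OmegaP => U /=; rewrite addrC. Qed.
Let add0 : left_id Omega_zero Omega_add.
Proof. by move=> a; apply: OmegaP => U /=; rewrite add0r. Qed.
Let addN : left_inverse Omega_zero Omega_opp Omega_add.
Proof. by move=> a; apply: OmegaP => U /=; rewrite addNr. Qed.

HB.instance Definition _ := GRing.isZmodule.Build Omega addA addC add0 addN.

Let mulA : associative Omega_mul.
Proof. by move=> a b c; apply: OmegaP => U /=; rewrite mulrA. Qed.
Let mul1 : left_id (Omega_of 1%g) Omega_mul.
Proof. by move=> a; apply: OmegaP => U /=; exact: mul1r. Qed.
Let mulr1 : right_id (Omega_of 1%g) Omega_mul.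
Proof. by move=> a; apply: OmegaP => U /=; exact: mulr1. Qed.
Let mulDl : left_distributive Omega_mul +%R.
Proof. by move=> a b c; apply: OmegaP => U /=; exact: mulrDl. Qed.
Let mulDr : right_distributive Omega_mul +%R.
Proof. by move=> a b c; apply: OmegaP => U /=; exact: mulrDr. Qed.

HB.instance Definition _ :=
  GRing.Zmodule_isPzRing.Build Omega mulA mul1 mulr1 mulDl mulDr.

Let setT_normal : normal_subgroup [set: G]. Proof. by split. Qed.

Let setT_finite : finite_set (range (lcosetg [set: G])).
Proof.
apply: (@sub_finite_set _ _ [set [set: G]]); last exact: finite_set1.
move=> _ [g _ <-]; apply/seteqP; split=> // x _.
by exists (g^-1 * x)%g => //; rewrite mulVKg.
Qed.

Let top_openNormal : openNormal G := OpenNormal openT setT_normal setT_finite.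

Let one_neq0 : (1 : Omega) != 0.
Proof.
by apply/eqP => /(congr1 (fun a : Omega => a top_openNormal))/eqP; apply/negP;
  exact: oner_neq0.
Qed.

HB.instance Definition _ := GRing.PzSemiRing_isNonZero.Build Omega one_neq0.

Let scaleA (k l : K) a : Omega_scale k (Omega_scale l a) = Omega_scale (k * l) a.
Proof. by apply: OmegaP => U /=; rewrite scalerA. Qed.
Let scale1 : left_id 1 Omega_scale.
Proof. by move=> a; apply: OmegaP => U /=; rewrite scale1r. Qed.
Let scaleDr : right_distributive Omega_scale +%R.
Proof. by move=> k a b; apply: OmegaP => U /=; exact: scalerDr. Qed.
Let scaleDl a : {morph Omega_scale^~ a : k l / k + l}.
Proof. by move=> k l; apply: OmegaP => U /=; exact: scalerDl. Qed.

HB.instance Definition _ :=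
  GRing.Zmodule_isLmodule.Build K Omega scaleA scale1 scaleDr scaleDl.

Let scaleAl (k : K) a b : k *: (a * b) = k *: a * b.
Proof. by apply: OmegaP => U /=; exact: scalerAl. Qed.
Let scaleAr (k : K) a b : k *: (a * b) = a * (k *: b).
Proof. by apply: OmegaP => U /=; exact: scalerAr. Qed.

HB.instance Definition _ := GRing.Lmodule_isLalgebra.Build K Omega scaleAl.
HB.instance Definition _ := GRing.Lalgebra_isAlgebra.Build K Omega scaleAr.

(* The augmentations of the components of a coincide by compatibility. *)
Definition aug_ideal : set Omega := [set a | forall U, galg_aug (a U) = 0].

End CompletedGroupAlgebra.

(* Algebraic product of ideals: finite sums of products. When G is a finitely
   generated pro-p group the powers of the augmentation ideal formed in this way
   are closed, so that no topological closure is taken. *)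
Definition ideal_mul (A : pzRingType) (I J : set A) : set A :=
  [set x | exists m (a b : 'I_m -> A),
     [/\ forall i, I (a i), forall i, J (b i) & x = \sum_i a i * b i]].

Definition ideal_exp (A : pzRingType) (I : set A) (n : nat) : set A :=
  iter n (fun J => ideal_mul J I) setT.

(* For subspaces B of A: the quotient A/B has a basis with n elements. *)
Definition has_quot_dim (K : fieldType) (V : lmodType K) (A B : set V)
    (n : nat) : Prop :=
  exists v : 'I_n -> V, (forall i, A (v i)) /\
    forall x, A x -> exists! c : 'rV[K]_n, B (x - \sum_i c 0 i *: v i).

(* The junk value 0 is taken when A/B is infinite-dimensional. *)
Definition quot_dim (K : fieldType) (V : lmodType K) (A B : set V) : nat :=
  xget 0%N [set n | has_quot_dim A B n].

Definition profinite (G : topGroupType) : Prop :=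
  [/\ compact [set: G], hausdorff_space G & totally_disconnected [set: G]].

Definition pro_p_group (p : nat) (G : topGroupType) : Prop :=
  profinite G /\ forall U : openNormal G, p.-nat #|{: quot U}|.

Definition continuous_hom (G H : topGroupType) (f : G -> H) : Prop :=
  {morph f : x y / (x * y)%g} /\ continuous f.

Definition free_pro_p_on (p d : nat) (F : topGroupType) (x : 'I_d -> F) : Prop :=
  pro_p_group p F /\
  forall (H : topGroupType) (y : 'I_d -> H), pro_p_group p H ->
    exists! f : F -> H, continuous_hom f /\ forall i, f (x i) = y i.

Definition closed_normal_closure (F : topGroupType) (A : set F) : set F :=
  [set x | forall N : set F,
     closed N -> normal_subgroup N -> A `<=` N -> N x].

(* Continuous cohomology with trivial coefficients K (K discrete), computed
   by inhomogeneous cochains *)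

Section Cohomology.
Variables (K : fieldType) (G : topGroupType).

Definition cochain (n : nat) := {ptws 'I_n -> G} -> K^o.

Definition continuous_cochain (n : nat) : set (cochain n) :=
  [set f | forall c : K, open (f @^-1` [set c])].

(* lift ord0 j has value j + 1, widen_ord _ j has value j. *)
Definition coboundary (n : nat) (f : cochain n) : cochain n.+1 :=
  fun g : 'I_n.+1 -> G =>
    f (fun j => g (lift ord0 j))
    + \sum_(i < n) (-1) ^+ i.+1 *
        f (fun j => if (j < i)%N then g (widen_ord (leqnSn n) j)
                    else if j == i then
                      (g (widen_ord (leqnSn n) j) * g (lift ord0 j))%g
                    else g (lift ord0 j))
    + (-1) ^+ n.+1 * f (fun j => g (widen_ord (leqnSn n) j)).

Definition cocycles (n : nat) : set (cochain n) :=
  [set f | continuous_cochain f /\ coboundary f = 0].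

Definition coboundaries (n : nat) : set (cochain n) :=
  if n is m.+1 then [set coboundary f | f in @continuous_cochain m]
  else [set 0].

Definition cohomology_dim (n : nat) : nat -> Prop :=
  has_quot_dim (@cocycles n) (@coboundaries n).

End Cohomology.

Record minimal_presentation (p d r : nat) (F G : topGroupType) (phi : F -> G)
    (rel : 'I_r -> F) : Prop := MinimalPresentation {
  minpres_generators : cohomology_dim 'F_p G 1 d;
  minpres_relations : cohomology_dim 'F_p G 2 r;
  minpres_free : exists x : 'I_d -> F, free_pro_p_on p x;
  minpres_hom : continuous_hom phi;
  minpres_surj : set_surj [set: F] [set: G] phi;
  minpres_ker : phi @^-1` [set 1%g] = closed_normal_closure (range rel)
}.

(* None stands for infinite depth. The junk value 0, for x != 1 lying in
   arbitrarily large powers, does not occur in finitely generated pro-p groups. *)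
Definition depth (p : nat) (F : topGroupType) (x : F) : option nat :=
  let in_power n :=
    ideal_exp (@aug_ideal 'F_p F) n (Omega_of 'F_p x - 1) in
  if `[< x = 1%g >] then None
  else Some (xget 0%N
         [set n | in_power n /\ forall m, in_power m -> (m <= n)%N]).

Definition golod_shafarevich_poly (R : realType) (p d r : nat)
    (F : topGroupType) (rel : 'I_r -> F) : {poly R} :=
  1 - d%:R *: 'X
  + \sum_(i < r) (if depth p (rel i) is Some n then 'X^n else 0).

Definition aug_coef (p : nat) (G : topGroupType) (n : nat) : nat :=
  if n is 0%N then 1%N
  else quot_dim (ideal_exp (@aug_ideal 'F_p G) n)
                (ideal_exp (@aug_ideal 'F_p G) n.+1).

Definition aug_growth (R : realType) (p : nat) (G : topGroupType) : \bar R :=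
  limn_esup (fun n => ((aug_coef p G n)%:R `^ n%:R^-1 : R)%:E).

(* Main.v *)
(* I_F is a free left Omega(F)-module on the x_i - 1: the coordinates are the Fox
   derivatives, which come from homomorphisms of F into the finite p-groups
   F_p[F/U] >| F/U, and which lower the filtration by the powers of I_F by at
   most one. Pushed forward to A = Omega(G), with augmentation ideal I and
   y_i = phi(x_i), this shows that the relations sum_i u_i (y_i - 1) in I^(n+1)
   are generated, modulo I^n, by the r vectors of Fox derivatives of the rho_j,
   whose entries lie in I^(omega_j - 1). Counting dimensions, s_n := dim A/I^n
   satisfies s_(n+1) - d s_n + sum_j s_(n+1-omega_j) >= 1 for all n. Multiplied
   by t_0^(n+1) and summed, these inequalities give d s_N t_0^N >= 1 for all
   N >= 1 as soon as P(G; t_0) < 0, which rules out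
   limsup c_n^(1/n) < 1/t_0. *)
Require Import Defs.
From HB Require Import structures.
From mathcomp Require Import all_boot all_order all_algebra all_fingroup.
From mathcomp Require Import all_classical all_reals all_analysis.
From mathcomp Require Import zify ring lra.
Set Implicit Arguments.
Unset Strict Implicit.
Unset Printing Implicit Defensive.
Import Order.TTheory GRing.Theory Num.Theory.

Local Open Scope classical_set_scope.
Local Open Scope ring_scope.

(** * Discrete groups and open normal subgroups *)

(** The obstacle is topological: [ideal_exp] is purely algebraic, while [Omega] is an inverse limit
    and the relators generate only a closed normal subgroup. Elements of [Omega] are therefore
    treated as distributions: compatible families of locally constant maps are integrated against
    them, and linear identities are checked on group elements only. The Fox expansion then shows by
    induction that every power of [I_F] contains the kernel of some [Omega(F) -> K[F/V]], hence is
    open. So all quotients by powers are finite, and the kernel of [Omega(F) -> Omega(G)] is needed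
    only modulo open ideals. As [K] is finite, dimensions are compared as cardinalities: the count
    is a single injection of finite sets. *)

Definition discrete_group (Q : finGroupType) : Type := Q.

Section DiscreteGroup.
Variable Q : finGroupType.

HB.instance Definition _ := monoid.Group.copy (discrete_group Q) Q.
HB.instance Definition _ := Finite.copy (discrete_group Q) Q.
HB.instance Definition _ := hasNbhs.Build (discrete_group Q) principal_filter.
HB.instance Definition _ := Discrete_ofNbhs.Build (discrete_group Q) erefl.

Let discrete_mulg_continuous :
  continuous (fun x : discrete_group Q * discrete_group Q => (x.1 * x.2)%g).
Proof.
move=> [x y] A /= Axy; exists ([set x], [set y]).
  by split; exact: discrete_set1.
by move=> [x' y'] [/= -> ->]; exact: nbhs_singleton.
Qed.

Let discrete_invg_continuous :
  continuous (fun x : discrete_group Q => x^-1%g).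
Proof.
move=> x A /= Ax; apply: (@filterS _ (nbhs x) _ [set x] (fun y => A y^-1%g)).
  by move=> _ ->; exact: nbhs_singleton.
exact: discrete_set1.
Qed.

HB.instance Definition _ := Group_Topological_isTopGroup.Build
  (discrete_group Q) discrete_mulg_continuous discrete_invg_continuous.

(** This admits finite [p]-groups as targets in the universal property of a free pro-[p] group.
    Every quotient is an image of [Q], so its order divides that of [Q]. *)
Lemma discrete_group_pro_p (p : nat) :
  p.-nat #|Q| -> pro_p_group p (discrete_group Q).
Proof.
move=> pQ; split=> [|U].
  split.
  - exact/finite_compact/finite_finset.
  - move=> x y /(_ [set x] [set y])/(_ (discrete_set1 x) (discrete_set1 y)).
    by move=> [z [-> ->]].
  - exact/zero_dimension_totally_disconnected/discrete_zero_dimension.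
pose pi (x : Q) : quot U := quot_pi U x.
have piM : {in [set: Q]%SET &, {morph pi : x y / (x * y)%g}}.
  by move=> x y _ _; exact: quot_piM.
have := dvdn_morphim (Morphism piM) [set: Q]%G.
rewrite cardsT /= => /pnat_dvd/(_ pQ).
rewrite (_ : _ @* _ = [set: quot U]%SET)%g ?cardsT//.
apply/setP => x; rewrite inE; have [g ->] := quot_piP x.
by apply/morphimP; exists g; rewrite ?inE.
Qed.

End DiscreteGroup.
HB.instance Definition _ (Q : finGroupType) := TopGroup.on (discrete_group Q).

Section OpenNormal.
Variable G : topGroupType.
Implicit Types U V W : openNormal G.

Lemma normal_subgroup_finite_range (N : set G) (T : finType) (f : G -> T) :
  normal_subgroup N -> (forall g h, f g = f h -> N (g^-1 * h)%g) ->
  finite_set (range (lcosetg N)).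
Proof.
move=> [N1 NM NV NJ] fN.
apply: (@sub_finite_set _ _
  [set lcosetg N (xget 1%g [set h | f h = t]) | t in [set: T]]).
  move=> _ [g _ <-]; exists (f g) => //; case: xgetP => [h _ /= fh|/(_ g)[]//].
  have Nhg := fN _ _ fh; apply/seteqP; split=> _ [u Nu <-].
    exists ((h^-1 * g)^-1 * u)%g; first by apply: NM => //; exact: NV.
    by rewrite invgM invgK !mulgA mulgV mul1g.
  by exists ((h^-1 * g) * u)%g; [exact: NM | rewrite !mulgA mulgV mul1g].
exact/finite_image/finite_finset.
Qed.

(** Finite index is part of [openNormal]; a map into a finite type that separates the cosets of [N]
    certifies it without compactness. *)
Lemma openNormal_exists (N : set G) (T : finType) (f : G -> T) :
  open N -> normal_subgroup N -> (forall g h, f g = f h -> N (g^-1 * h)%g) ->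
  exists U : openNormal G, openNormal_set U = N.
Proof.
by move=> oN nN fN; exists (OpenNormal oN nN (normal_subgroup_finite_range nN fN)).
Qed.

Lemma openNormalT : exists U : openNormal G, openNormal_set U = setT.
Proof.
apply: (@openNormal_exists _ unit (fun=> tt)); [exact: openT|by split|by []].
Qed.

Lemma openNormalI U V :
  exists W, openNormal_set W = U `&` V.
Proof.
apply: (@openNormal_exists _ (quot U * quot V)%type
  (fun g => (quot_pi U g, quot_pi V g))).
- by apply: openI; exact: openNormal_open.
- have [U1 UM UV UJ] := openNormal_normal U.
  have [V1 VM VV VJ] := openNormal_normal V.
  split=> // [x y [? ?] [? ?]|x [? ?]|x g [? ?]].
  + by split; [exact: UM|exact: VM].
  + by split; [exact: UV|exact: VV].
  + by split; [exact: UJ|exact: VJ].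
- by move=> g h /pair_equal_spec[/quot_piE ? /quot_piE ?]; split.
Qed.

Lemma openNormal_preim (H : topGroupType) (f : G -> H) (U : openNormal H) :
  continuous_hom f -> exists W, openNormal_set W = f @^-1` U.
Proof.
move=> [fM fC].
have f1 : f 1%g = 1%g by apply: (mulgI (f 1%g)); rewrite -fM !mulg1.
have fV x : f x^-1%g = (f x)^-1%g.
  by apply: (mulgI (f x)); rewrite -fM !mulgV.
have [U1 UM UV UJ] := openNormal_normal U.
apply: (@openNormal_exists _ (quot U) (fun g => quot_pi U (f g))).
- by apply: open_comp => [x _|]; [exact: fC|exact: openNormal_open].
- split=> /= [|x y|x|x g].
  + by rewrite f1.
  + by rewrite fM; exact: UM.
  + by rewrite fV; exact: UV.
  + by rewrite /conjg !fM fV; exact: UJ.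
- by move=> g h /quot_piE; rewrite /= fM fV.
Qed.

Lemma nbhs_lcosetg V g : nbhs g [set x | openNormal_set V (g^-1 * x)%g].
Proof.
have cg : {for g, continuous (fun x : G => (g^-1 * x)%g)}.
  move=> A /= nA.
  have /= := @mulg_continuous G (g^-1%g, g) A nA.
  move=> [[B C] [/= gB gC] BC]; apply: filterS gC => x Cx.
  by apply: (BC (_, _)); split => //=; exact: nbhs_singleton.
apply: cg; rewrite mulVg; apply: open_nbhs_nbhs; split.
  exact: openNormal_open.
by have [] := openNormal_normal V.
Qed.

Lemma open_subgroup (N : set G) V : normal_subgroup N -> V `<=` N -> open N.
Proof.
move=> [N1 NM NV NJ] VN; rewrite openE => g Ng.
apply: filterS (nbhs_lcosetg V g) => x /VN Nx.
by rewrite -(mulVKg g x); exact: NM.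
Qed.

Lemma openNormal_super (N : set G) V : normal_subgroup N -> V `<=` N ->
  exists W, openNormal_set W = N.
Proof.
move=> nN VN; apply: (@openNormal_exists _ (quot V) (quot_pi V)) => //.
  exact: open_subgroup nN VN.
by move=> g h /quot_piE /VN.
Qed.

(** The complement is a union of cosets of [V]. Closedness matters because [closed_normal_closure]
    tests closed subgroups only. *)
Lemma open_subgroup_closed (N : set G) V :
  normal_subgroup N -> V `<=` N -> closed N.
Proof.
move=> [N1 NM NV NJ] VN; rewrite -openC openE => g Ng.
apply: filterS (nbhs_lcosetg V g) => x /VN Nx Nx'; apply: Ng.
rewrite (_ : g = (x * (g^-1 * x)^-1)%g); first by apply: NM => //; exact: NV.
by rewrite invgM invgK mulgA mulgV mul1g.
Qed.

End OpenNormal.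

(** * Integration of locally constant functions *)

Section LocallyConstant.
Variables (G : topGroupType) (T : Type).
Implicit Types (h : G -> T) (U V : openNormal G).

Definition coset_const V h : Prop :=
  forall g v, openNormal_set V v -> h (g * v)%g = h g.

(** Uniform local constancy: a single [V] serves all points, so [h] factors through a finite
    quotient. *)
Definition loc_const h : Prop := exists V, coset_const V h.

Definition quot_rep V (q : quot V) : G := xget 1%g (val q).

Lemma quot_repK V (q : quot V) : quot_pi V (quot_rep q) = q.
Proof.
have [g ->] := quot_piP q; apply/quot_piE; rewrite /quot_rep.
have [V1 _ VV _] := openNormal_normal V; case: xgetP => [h _ /= [u Vu <-]|/(_ g)].
  by rewrite invgM mulgKV; apply: VV.
by case; exists 1%g => //; rewrite mulg1.
Qed.

Lemma coset_constP V h g g' : coset_const V h ->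
  quot_pi V g = quot_pi V g' -> h g = h g'.
Proof. by move=> hV /quot_piE Vgg; rewrite -(mulVKg g g') hV. Qed.

Lemma coset_const_sub U V h : U `<=` V -> coset_const V h -> coset_const U h.
Proof. by move=> UV hV g v /UV; exact: hV. Qed.

End LocallyConstant.

Lemma loc_const_comp (G : topGroupType) (T S : Type) (f : T -> S) (h : G -> T) :
  loc_const h -> loc_const (f \o h).
Proof. by move=> [V hV]; exists V => g v Vv /=; rewrite hV. Qed.

Lemma coset_const_pi (G : topGroupType) (V : openNormal G) :
  coset_const V (quot_pi V).
Proof. by move=> g v Vv; apply/esym/quot_piE; rewrite mulKg. Qed.

Lemma loc_const_fam (G : topGroupType) (I : finType) (T : I -> Type)
    (h : forall i, G -> T i) :
  (forall i, loc_const (h i)) -> exists V, forall i, coset_const V (h i).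
Proof.
move=> hl.
suff [V hV] : exists V, forall i, i \in enum I -> coset_const V (h i).
  by exists V => i; apply: hV; rewrite mem_enum.
elim: (enum I) => [|i s [V hV]]; first by have [V _] := openNormalT G; exists V.
have [W hW] := hl i; have [X XE] := openNormalI V W.
exists X => j; rewrite inE => /orP[/eqP ->|js].
  by apply: coset_const_sub hW; rewrite XE => ? [].
by apply: coset_const_sub (hV j js); rewrite XE => ? [].
Qed.

Lemma loc_const2 (G : topGroupType) (T S R : Type) (f : T -> S -> R)
    (h : G -> T) (k : G -> S) :
  loc_const h -> loc_const k -> loc_const (fun g => f (h g) (k g)).
Proof.
move=> [V hV] [W kW]; have [X XE] := openNormalI V W.
exists X => g v; rewrite XE => -[Vv Wv]; congr f; [exact: hV|exact: kW].
Qed.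

Lemma loc_const_cst (G : topGroupType) (T : Type) (t : T) :
  loc_const (fun _ : G => t).
Proof. by have [V _] := openNormalT G; exists V. Qed.

Section GroupAlgebraBasics.
Variables (K : fieldType) (Q : finGroupType).

Lemma galg_ofM (x y : Q) : galg_of K (x * y)%g = galg_of K x * galg_of K y.
Proof.
apply/ffunP => z; rewrite !ffunE (bigD1 x)//= !ffunE eqxx mul1r big1 ?addr0.
  by rewrite -(inj_eq (mulgI x^-1%g)) mulKg.
by move=> i /negbTE ix; rewrite ffunE ix mul0r.
Qed.

Lemma galg_of1 : galg_of K (1%g : Q) = 1. Proof. by []. Qed.

Lemma galg_sum (a : galg K Q) : a = \sum_q a q *: galg_of K q.
Proof.
apply/ffunP => z; rewrite sum_ffunE (bigD1 z)//= big1 ?addr0.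
  by rewrite !ffunE eqxx /= /GRing.scale /= mulr1.
move=> i /negbTE iz; rewrite !ffunE /GRing.scale /= eq_sym iz mulr0.
by [].
Qed.

Lemma galg_map_linear (Q' : finGroupType) (f : Q -> Q') :
  linear (@galg_map K Q Q' f).
Proof. by move=> k a b; rewrite galg_mapD galg_mapZ. Qed.

End GroupAlgebraBasics.

Section Integral.
Variables (K : fieldType) (G : topGroupType).
Implicit Types (U V W : openNormal G) (a b : Omega K G).

Definition coset_sum (M : lmodType K) V (h : G -> M) a : M :=
  \sum_(q : quot V) a V q *: h (quot_rep q).

(** By compatibility, the coefficient of [a] at a coset of [V] is the sum of its coefficients at the
    cosets of [W] inside it. This makes the integral independent of the level. *)
Lemma coset_sum_sub (M : lmodType K) V W (h : G -> M) a :
  W `<=` V -> coset_const V h -> coset_sum W h a = coset_sum V h a.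
Proof.
move=> WV hV; rewrite /coset_sum.
rewrite (partition_big (@quot_map _ W V) predT)//=.
apply: eq_bigr => q _; rewrite -(Omega_compat a WV) ffunE scaler_suml.
apply: eq_bigr => x /eqP xq; congr (_ *: _).
apply: (coset_constP hV); rewrite quot_repK -xq -[in RHS](quot_repK x).
by rewrite quot_map_pi.
Qed.

(* A linear form on locally constant functions: [a] is a distribution on [G],
   and this is the integral of [h] against it (0 if [h] is not locally
   constant). *)
Definition intg (M : lmodType K) (h : G -> M) a : M :=
  if pselect (loc_const h) is left hl then coset_sum (projT1 (cid hl)) h a
  else 0.

Lemma intgE (M : lmodType K) V (h : G -> M) a :
  coset_const V h -> intg h a = coset_sum V h a.
Proof.
move=> hV; rewrite /intg; case: pselect => [hl|[]]; last by exists V.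
case: cid => W hW /=; have [X XE] := openNormalI V W.
rewrite -(@coset_sum_sub _ V X)// ?XE; last by move=> ? [].
by rewrite -(@coset_sum_sub _ W X)// XE => ? [].
Qed.

Lemma intg_linear (M : lmodType K) (h : G -> M) : linear (intg h).
Proof.
move=> k a b; have [[V hV]|nh] := pselect (loc_const h); last first.
  by rewrite /intg; case: pselect => // _; rewrite scaler0 addr0.
rewrite !(intgE _ hV) scaler_sumr -big_split; apply: eq_bigr => q _ /=.
by rewrite !ffunE scalerDl scalerA.
Qed.

HB.instance Definition _ (M : lmodType K) (h : G -> M) :=
  GRing.isLinear.Build K (Omega K G) M _ (intg h) (intg_linear h).

Lemma intg_comp (M N : lmodType K) (L : M -> N) (h : G -> M) a :
  linear L -> loc_const h -> intg (L \o h) a = L (intg h a).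
Proof.
move=> Llin [V hV].
pose L' : {linear M -> N} := HB.pack L (GRing.isLinear.Build _ _ _ _ L Llin).
have LhV : coset_const V (L \o h) by move=> g v Vv /=; rewrite hV.
rewrite (intgE _ LhV) (intgE _ hV) -[L]/(L' : M -> N) linear_sum.
by apply: eq_bigr => q _; rewrite linearZ.
Qed.

Lemma intg_fun_sum (M : lmodType K) (I : finType) (h : I -> G -> M) a :
  (forall i, loc_const (h i)) ->
  intg (fun g => \sum_i h i g) a = \sum_i intg (h i) a.
Proof.
move=> /loc_const_fam[V hV].
rewrite (@intgE _ V); last by move=> g v Vv; apply: eq_bigr => i _; rewrite hV.
under [RHS]eq_bigr do rewrite (@intgE _ V)//.
rewrite exchange_big; apply: eq_bigr => q _ /=; by rewrite scaler_sumr.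
Qed.

Lemma intg_fun_add (M : lmodType K) (h k : G -> M) a :
  loc_const h -> loc_const k ->
  intg (fun g => h g + k g) a = intg h a + intg k a.
Proof.
move=> hl kl; have := @intg_fun_sum M bool (fun c : bool => if c then h else k) a.
rewrite big_bool /= => <-; last by case.
by congr intg; apply/funext => g; rewrite big_bool.
Qed.

Lemma intg_of (M : lmodType K) (h : G -> M) g :
  loc_const h -> intg h (Omega_of K g) = h g.
Proof.
move=> [V hV]; rewrite (intgE _ hV) /coset_sum (bigD1 (quot_pi V g))//=.
rewrite ffunE eqxx scale1r big1 ?addr0.
  by apply: (coset_constP hV); rewrite quot_repK.
by move=> q /negbTE qg; rewrite ffunE qg scale0r.
Qed.

(** Multiplication in [Omega] is convolution, so this is Fubini's formula. Normality of [V] is what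
    keeps the inner integral [V]-invariant in [g]. *)
Lemma intg_mul (M : lmodType K) (h : G -> M) a b : loc_const h ->
  intg h (a * b) = intg (fun g => intg (fun g' => h (g * g')%g) b) a.
Proof.
move=> [V hV].
have hVl g : coset_const V (fun g' => h (g * g')%g).
  by move=> g' v Vv /=; rewrite mulgA; exact: hV.
have hVr : coset_const V (fun g => intg (fun g' => h (g * g')%g) b).
  move=> g v Vv; congr intg; apply/funext => g' /=.
  rewrite -mulgA (_ : (v * g' = g' * v ^ g')%g).
    rewrite mulgA; apply: hV; have [_ _ _ VJ] := openNormal_normal V; exact: VJ.
  by rewrite /conjg mulgA mulgV mul1g.
rewrite (intgE _ hV) (intgE _ hVr) /coset_sum.
under eq_bigr do rewrite ffunE scaler_suml.
rewrite exchange_big; apply: eq_bigr => y _ /=.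
rewrite (intgE _ (hVl _)) /coset_sum scaler_sumr.
rewrite (reindex_inj (mulgI y)) /=; apply: eq_bigr => z _.
rewrite mulKg scalerA; congr (_ *: _); apply: (coset_constP hV).
by rewrite quot_repK quot_piM !quot_repK.
Qed.

(** With this, a linear identity on [Omega(G)] follows from its case on group elements by
    integrating both sides against [a]. *)
Lemma Omega_intg U a : a U = intg (fun g => galg_of K (quot_pi U g)) a.
Proof.
rewrite (@intgE _ U); last by move=> g v Uv; rewrite coset_const_pi.
by rewrite [LHS]galg_sum; apply: eq_bigr => q _; rewrite quot_repK.
Qed.

Definition Omega_aug a : K^o := intg (fun=> 1 : K^o) a.

HB.instance Definition _ := GRing.isLinear.Build K (Omega K G) K^o _ Omega_aug
  (intg_linear (fun=> 1 : K^o)).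

Lemma Omega_augE U a : Omega_aug a = galg_aug (a U).
Proof.
rewrite /Omega_aug (@intgE _ U)// /coset_sum; apply: eq_bigr => q _.
by rewrite /GRing.scale /= mulr1.
Qed.

Lemma aug_idealE : @aug_ideal K G = [set a | Omega_aug a = 0].
Proof.
apply/seteqP; split=> a /= => [a0|a0 U]; last by rewrite -Omega_augE.
by have [U _] := openNormalT G; rewrite (Omega_augE U).
Qed.

Lemma Omega_aug_of g : Omega_aug (Omega_of K g) = 1.
Proof. by rewrite /Omega_aug intg_of//; exact: loc_const_cst. Qed.

Lemma Omega_augM a b : Omega_aug (a * b) = Omega_aug a * Omega_aug b.
Proof.
rewrite {1}/Omega_aug intg_mul; last exact: loc_const_cst.
rewrite -[RHS]/((fun x : K^o => x * Omega_aug b : K^o) (Omega_aug a)).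
rewrite -intg_comp; last exact: loc_const_cst; last first.
  by move=> k x y; rewrite mulrDl -scalerAl.
by congr intg; apply/funext => g /=; rewrite mul1r.
Qed.

Lemma Omega_of1 : Omega_of K (1%g : G) = 1. Proof. by []. Qed.

Lemma Omega_ofM (g h : G) : Omega_of K (g * h)%g = Omega_of K g * Omega_of K h.
Proof. by apply: OmegaP => U /=; rewrite quot_piM galg_ofM. Qed.

Lemma Omega_sum_comp (I : Type) (s : seq I) (P : pred I) (f : I -> Omega K G) U :
  (\sum_(i <- s | P i) f i) U = \sum_(i <- s | P i) (f i) U.
Proof. by elim/big_rec2 : _ => // i x y _ <-. Qed.

End Integral.

(** * Linear maps between completed group algebras defined by integration *)

Section Push.
Variables (K : fieldType) (G H : topGroupType).
Variable h : forall U : openNormal H, G -> galg K (quot U).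
Hypothesis h_loc : forall U, loc_const (h U).
Hypothesis h_compat : forall (U V : openNormal H) g, U `<=` V ->
  galg_map (@quot_map H U V) (h U g) = h V g.

Lemma push_subproof (a : Omega K G) : compatible (fun U => intg (h U) a).
Proof.
move=> U V UV; rewrite -(intg_comp _ (@galg_map_linear _ _ _ _)); last exact: h_loc.
by congr intg; apply/funext => g /=; exact: h_compat.
Qed.

(** The linear extension of the map [G -> Omega(H)] with components [h U]; Fox derivatives and
    functoriality in the group are both instances. *)
Definition push (a : Omega K G) : Omega K H := MkOmega (push_subproof a).

Lemma push_linear : linear push.
Proof. by move=> k a b; apply: OmegaP => U /=; rewrite linearP. Qed.

End Push.

(** * Derivations of a free pro-p group *)

(* The semidirect product K[Q] >| Q: homomorphisms into it over a given map
   G -> Q are the derivations of G with values in K[Q]. *)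
Definition fox_group (K : finFieldType) (Q : finGroupType) : Type :=
  ({ffun Q -> K} * Q)%type.

Section FoxGroup.
Variables (K : finFieldType) (Q : finGroupType).
Notation T := (fox_group K Q).

HB.instance Definition _ := Finite.copy T ({ffun Q -> K} * Q)%type.

Definition fox_mul (x y : T) : T :=
  ((x.1 : galg K Q) + galg_of K x.2 * (y.1 : galg K Q), (x.2 * y.2)%g).
Definition fox_one : T := (0 : galg K Q, 1%g).
Definition fox_inv (x : T) : T :=
  (- (galg_of K x.2^-1%g * (x.1 : galg K Q)), x.2^-1%g).

Let fox_mulA : associative fox_mul.
Proof.
move=> x y z; apply: injective_projections => /=; last by rewrite mulgA.
by rewrite galg_ofM mulrDr addrA mulrA.
Qed.

Let fox_mul1 : left_id fox_one fox_mul.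
Proof.
move=> [a x]; apply: injective_projections => /=; last by rewrite mul1g.
by rewrite galg_of1 mul1r add0r.
Qed.

Let fox_mulV : left_inverse fox_one fox_inv fox_mul.
Proof.
move=> [a x]; apply: injective_projections => /=; last by rewrite mulVg.
by rewrite addNr.
Qed.

HB.instance Definition _ :=
  Finite_isGroup.Build T fox_mulA fox_mul1 fox_mulV.

Lemma card_fox_group : #|{: T}| = (#|K| ^ #|Q| * #|Q|)%N.
Proof. by rewrite card_prod card_ffun. Qed.

End FoxGroup.

Section ContinuousHom.
Variables (F : topGroupType) (Q : finGroupType).

Lemma loc_const_continuous (f : F -> discrete_group Q) :
  loc_const f -> continuous f.
Proof.
move=> [V fV] g A /= /nbhs_singleton Afg.
apply: filterS (nbhs_lcosetg V g) => x /= Vgx.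
by rewrite -(mulVKg g x) fV.
Qed.

Lemma continuous_hom_loc_const (f : F -> discrete_group Q) :
  continuous_hom f -> loc_const f.
Proof.
move=> fh; have [U UE] : exists U : openNormal (discrete_group Q),
    openNormal_set U = [set 1%g].
  apply: (@openNormal_exists (discrete_group Q) [set 1%g] Q (fun g => g)).
  - exact: discrete_open.
  - split=> [//|_ _ -> ->|_ ->|_ g ->] /=.
    + by rewrite mulg1.
    + by rewrite invg1.
    + by rewrite /conjg mul1g mulVg.
  - by move=> g h <- /=; rewrite mulVg.
have [W WE] := openNormal_preim U fh; exists W => g v.
by rewrite WE UE /= => fv; case: fh => fM _; rewrite fM fv mulg1.
Qed.

End ContinuousHom.

Section Derivations.
Variables (K : finFieldType) (p : nat) (F : topGroupType) (d : nat).
Variable x : 'I_d -> F.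
Hypotheses (pK : p.-nat #|K|) (xfree : free_pro_p_on p x).
Implicit Types U V : openNormal F.

Definition derivation U (D : F -> galg K (quot U)) : Prop :=
  forall g h, D (g * h)%g = D g + galg_of K (quot_pi U g) * D h.

Let fox_pro_p U : pro_p_group p (discrete_group (fox_group K (quot U))).
Proof.
apply: discrete_group_pro_p; rewrite card_fox_group pnatM pnatX pK /=.
by have [[_ ->]] := xfree.
Qed.

Let fox_pt U (a : galg K (quot U)) (q : quot U) :
  discrete_group (fox_group K (quot U)) := (a, q).

Let fox_hom U (D : F -> galg K (quot U)) (g : F) :
  discrete_group (fox_group K (quot U)) := (D g, quot_pi U g).

Let fox_homP U (D : F -> galg K (quot U)) :
  loc_const D -> derivation D -> continuous_hom (fox_hom D).
Proof.
move=> Dl DD; split.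
  by move=> g h; apply: injective_projections; [exact: DD|exact: quot_piM].
apply: loc_const_continuous; apply: (loc_const2 _ Dl).
by exists U; exact: coset_const_pi.
Qed.

(** Elements of a free pro-[p] group need not be words in the generators, so identities between
    derivations are proved through this uniqueness instead of by induction on words. *)
Lemma derivation_unique U (D D' : F -> galg K (quot U)) :
  loc_const D -> derivation D -> loc_const D' -> derivation D' ->
  (forall i, D (x i) = D' (x i)) -> D = D'.
Proof.
move=> Dl DD Dl' DD' DDx.
have [_ /(_ _ (fun i => fox_hom D (x i)) (fox_pro_p U))[f [_ fu]]] := xfree.
have fD : f = fox_hom D by apply: fu; split=> //; exact: fox_homP.
have fD' : f = fox_hom D'.
  by apply: fu; split=> [|i]; [exact: fox_homP|rewrite /fox_hom DDx].
apply/funext => g; have := congr1 (fun f : F -> _ => f g) fD.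
by rewrite fD' /fox_hom => -[].
Qed.

Lemma derivation_exists U (m : 'I_d -> galg K (quot U)) :
  exists D : F -> galg K (quot U),
    [/\ loc_const D, derivation D & forall i, D (x i) = m i].
Proof.
have [_ xu] := xfree.
have [f [[fh fx] _]] := xu _ (fun i => fox_pt (m i) (quot_pi U (x i))) (fox_pro_p U).
have fl := continuous_hom_loc_const fh; have [fM _] := fh.
(* That [f] lies over the projection to [F/U] is not part of its definition. Its second component
   and the projection, both paired with the zero vector, are homomorphisms into the same group that
   agree on the generators. *)
have f2 g : (f g).2 = quot_pi U g.
  have [f' [_ fu']] := xu _ (fun i => fox_pt 0 (quot_pi U (x i))) (fox_pro_p U).
  pose f0 g := fox_pt 0 (f g).2.
  have f0E : f' = f0.
    apply: fu'; split; last by move=> i; rewrite /f0 fx.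
    split; last first.
      exact/loc_const_continuous/(loc_const_comp (fun y => fox_pt 0 y.2) fl).
    move=> a b; rewrite /f0 fM; apply: injective_projections => //=.
    by rewrite mulr0 addr0.
  have f1E : f' = fox_hom (fun=> 0).
    apply: fu'; split=> //; apply: fox_homP; first exact: loc_const_cst.
    by move=> a b; rewrite mulr0 addr0.
  have := congr1 (fun f : F -> _ => (f g).2) f0E.
  by rewrite f1E => /= ->.
exists (fun g => (f g).1 : galg K (quot U)); split.
- exact: (loc_const_comp fst fl).
- by move=> g h; rewrite fM /= f2.
- by move=> i; rewrite fx.
Qed.

Lemma derivation1 U (D : F -> galg K (quot U)) : derivation D -> D 1%g = 0.
Proof.
move=> /(_ 1%g 1%g); rewrite mulg1 -[galg_of _ _]/(1 : galg K (quot U)) mul1r.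
by move=> D1; apply: (addrI (D 1%g)); rewrite addr0 -D1.
Qed.

End Derivations.

(** * Powers of ideals and Fox derivatives *)

Section Ideals.
Variable A : pzRingType.
Implicit Types I J E : set A.

Definition two_sided_ideal I : Prop :=
  [/\ I 0, forall x y, I x -> I y -> I (x + y),
      forall a x, I x -> I (a * x) & forall a x, I x -> I (x * a)].

Lemma ideal_opp I x : two_sided_ideal I -> I x -> I (- x).
Proof. by move=> [_ _ IM _] Ix; rewrite -mulN1r; exact: IM. Qed.

Lemma ideal_sub I x y : two_sided_ideal I -> I x -> I y -> I (x - y).
Proof. by move=> iI Ix Iy; have [_ ID _ _] := iI; apply/ID/(ideal_opp iI). Qed.

Lemma ideal_sum I (T : Type) (s : seq T) (P : pred T) (f : T -> A) :
  two_sided_ideal I -> (forall i, P i -> I (f i)) ->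
  I (\sum_(i <- s | P i) f i).
Proof. by move=> [I0 ID _ _] If; elim/big_rec : _ => // i x Pi; exact/ID/If. Qed.

Lemma ideal_mul_subset I J E : E 0 -> (forall x y, E x -> E y -> E (x + y)) ->
  (forall a b, I a -> J b -> E (a * b)) -> ideal_mul I J `<=` E.
Proof.
move=> E0 ED EM _ [m [a [b [Ia Jb ->]]]].
by elim/big_rec : _ => // i x _; apply: ED; exact: EM.
Qed.

Lemma ideal_mulP I J a b : I a -> J b -> ideal_mul I J (a * b).
Proof.
by move=> Ia Jb; exists 1%N, (fun=> a), (fun=> b); split=> //; rewrite big_ord1.
Qed.

Lemma ideal_mul_two_sided I J :
  two_sided_ideal I -> two_sided_ideal J -> two_sided_ideal (ideal_mul I J).
Proof.
move=> [_ _ IM _] [_ _ _ JM]; split.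
- exists 0%N, (fun=> 0), (fun=> 0); split; [by case|by case|].
  by rewrite big_ord0.
- move=> _ _ [m [a [b [Ia Jb ->]]]] [n [a' [b' [Ia' Jb' ->]]]].
  exists (m + n)%N,
    (fun i => match fintype.split i with inl j => a j | inr k => a' k end),
    (fun i => match fintype.split i with inl j => b j | inr k => b' k end).
  split; [by move=> i; case: fintype.split..|].
  rewrite big_split_ord; congr (_ + _); apply: eq_bigr => i _.
    case: splitP => j /= ij; first by rewrite (val_inj ij).
    by move: (ltn_ord i); rewrite ij ltnNge leq_addr.
  case: splitP => j /= ij; last by move/addnI: ij => /val_inj ->.
  by move: (ltn_ord j); rewrite -ij ltnNge leq_addr.
- move=> c _ [m [a [b [Ia Jb ->]]]]; exists m, (fun i => c * a i), b; split=> //.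
    by move=> i; exact: IM.
  by rewrite mulr_sumr; apply: eq_bigr => i _; rewrite mulrA.
- move=> c _ [m [a [b [Ia Jb ->]]]]; exists m, a, (fun i => b i * c); split=> //.
    by move=> i; exact: JM.
  by rewrite mulr_suml; apply: eq_bigr => i _; rewrite mulrA.
Qed.

Section Powers.
Variable I : set A.
Hypothesis iI : two_sided_ideal I.

Lemma ideal_exp_two_sided n : two_sided_ideal (ideal_exp I n).
Proof. by elim: n => // n IHn; exact: ideal_mul_two_sided. Qed.

Lemma ideal_exp1 : ideal_exp I 1 = I.
Proof.
apply/seteqP; split=> [|x Ix]; last by rewrite -(mul1r x); exact: ideal_mulP.
by case: iI => I0 ID IM _; apply: ideal_mul_subset => // a b _; exact: IM.
Qed.

Lemma ideal_expS_sub n : ideal_exp I n.+1 `<=` ideal_exp I n.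
Proof.
have [? ? _ IM] := ideal_exp_two_sided n.
by apply: ideal_mul_subset => // a b + _; exact: IM.
Qed.

Lemma ideal_exp_le m n : (m <= n)%N -> ideal_exp I n `<=` ideal_exp I m.
Proof.
move=> /subnK <-; elim: (n - m)%N => // k IHk.
exact: subset_trans (@ideal_expS_sub _) IHk.
Qed.

Lemma ideal_exp_add m n a b :
  ideal_exp I m a -> ideal_exp I n b -> ideal_exp I (m + n) (a * b).
Proof.
elim: n b => [|n IHn] b Ia; first by
  have [_ _ _ IM] := ideal_exp_two_sided m; rewrite addn0 => _; exact: IM.
rewrite addnS => -[k [u [v [Iu Iv ->]]]]; rewrite mulr_sumr.
apply: ideal_sum => [|i _]; first exact: (ideal_exp_two_sided _.+1).
by rewrite mulrA; apply: ideal_mulP; [apply: IHn => //; exact: Iu|exact: Iv].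
Qed.

End Powers.
End Ideals.

Section IdealImage.
Variables (A B : pzRingType) (f : {rmorphism A -> B}) (I : set A) (J : set B).
Hypotheses (f_surj : forall b, exists a, f a = b).
Hypothesis fIJ : forall a, I a <-> J (f a).

Lemma ideal_exp_image n a : ideal_exp I n a -> ideal_exp J n (f a).
Proof.
elim: n a => // n IHn _ [m [u [v [Iu Iv ->]]]].
exists m, (f \o u), (f \o v); split=> [i|i|] /=; first exact/IHn/Iu.
  exact/fIJ/Iv.
by rewrite rmorph_sum; apply: eq_bigr => i _; rewrite rmorphM.
Qed.

Lemma ideal_exp_lift n b : ideal_exp J n b -> exists2 a, ideal_exp I n a & f a = b.
Proof.
elim: n b => [|n IHn] b; first by have [a] := f_surj b; exists a.
move=> [m [u [v [Ju Jv ->]]]].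
have /choice[u' u'P] i : exists a, ideal_exp I n a /\ f a = u i.
  by have [a] := IHn _ (Ju i); exists a.
have /choice[v' v'P] i : exists a, f a = v i by exact: f_surj.
exists (\sum_i u' i * v' i).
  exists m, u', v'; split=> [i|i|//]; first by have [] := u'P i.
  by apply/fIJ; rewrite v'P.
by rewrite rmorph_sum; apply: eq_bigr => i _; rewrite rmorphM v'P; have [_ ->] := u'P i.
Qed.

End IdealImage.

Lemma aug_ideal_two_sided (K : fieldType) (G : topGroupType) :
  two_sided_ideal (@aug_ideal K G).
Proof.
rewrite aug_idealE; split=> /= [|x y x0 y0|a x x0|a x x0].
- exact: raddf0.
- by rewrite raddfD /= x0 y0 addr0.
- by rewrite Omega_augM x0 mulr0.
- by rewrite Omega_augM x0 mul0r.
Qed.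

(** * Fox derivatives on the completed group algebra *)

Section FoxDerivatives.
Variables (K : finFieldType) (p : nat) (F : topGroupType) (d : nat).
Variable x : 'I_d -> F.
Hypotheses (pK : p.-nat #|K|) (xfree : free_pro_p_on p x).
Implicit Types U V : openNormal F.
Notation B := (Omega K F).
Notation I := (@aug_ideal K F).

Let fox_exists U i := derivation_exists pK xfree
  (fun j => (j == i)%:R : galg K (quot U)).

Let fox i U : F -> galg K (quot U) := projT1 (cid (fox_exists U i)).

Let fox_loc i U : loc_const (fox i U).
Proof. by rewrite /fox; case: cid => ? []. Qed.

Let fox_der i U : derivation (fox i U).
Proof. by rewrite /fox; case: cid => ? []. Qed.

Let fox_gen i U j : fox i U (x j) = (j == i)%:R.
Proof. by rewrite /fox; case: cid => ? []. Qed.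

(** Pushed down to [K[F/V]], the derivation at level [U] keeps its values on the generators, so
    uniqueness identifies it with the one at level [V]. This glues the finite levels. *)
Let fox_compat i U V g : U `<=` V ->
  galg_map (@quot_map F U V) (fox i U g) = fox i V g.
Proof.
move=> UV; suff /(congr1 (fun D : F -> _ => D g)) :
  galg_map (@quot_map F U V) \o fox i U = fox i V by [].
apply: (derivation_unique pK xfree) => //.
- exact: (loc_const_comp (galg_map (@quot_map F U V)) (fox_loc i U)).
- move=> a b /=; rewrite fox_der galg_mapD galg_mapM; last exact: quot_mapM.
  by rewrite galg_map_of quot_map_pi.
- move=> j /=; rewrite !fox_gen.
  by case: (j == i); [apply/galg_map1/quot_mapM|exact: galg_map0].
Qed.

Definition Fox i : B -> B := push (fox_loc i) (@fox_compat i).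

HB.instance Definition _ i :=
  GRing.isLinear.Build K B B _ (Fox i) (push_linear (fox_loc i) (@fox_compat i)).

(** The derivation rule on group elements, integrated over the second factor against [b] and then
    over the first against [a]; the term constant in the second factor picks up the total mass
    [Omega_aug b]. *)
Lemma FoxM i a b : Fox i (a * b) = Omega_aug b *: Fox i a + a * Fox i b.
Proof.
apply: OmegaP => U /=; rewrite intg_mul; last exact: fox_loc.
have E g : intg (fun h => fox i U (g * h)%g) b =
    Omega_aug b *: fox i U g + galg_of K (quot_pi U g) * intg (fox i U) b.
  rewrite (_ : (fun h => _) = (fun h => fox i U g +
    galg_of K (quot_pi U g) * fox i U h)); last by apply/funext => h; exact: fox_der.
  rewrite intg_fun_add; first last.
  - exact: (loc_const_comp (fun y => galg_of K (quot_pi U g) * y) (fox_loc i U)).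
  - exact: loc_const_cst.
  congr (_ + _).
    rewrite -[RHS]/((fun k : K^o => k *: fox i U g) (Omega_aug b)) -intg_comp//.
    + by congr intg; apply/funext => h /=; rewrite scale1r.
    + by move=> k u v; rewrite scalerDl scalerA.
    + exact: loc_const_cst.
  rewrite -[RHS]/((fun y => galg_of K (quot_pi U g) * y) (intg (fox i U) b)).
  by rewrite -intg_comp//; [move=> k u v; rewrite mulrDr scalerAr|exact: fox_loc].
rewrite (funext E).
rewrite intg_fun_add; first last.
- apply: (loc_const_comp (fun q => galg_of K q * intg (fox i U) b)).
  by exists U; exact: coset_const_pi.
- exact: (loc_const_comp (fun y => Omega_aug b *: y) (fox_loc i U)).
congr (_ + _).
  rewrite -[RHS]/((fun y => Omega_aug b *: y) (intg (fox i U) a)).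
  by rewrite -intg_comp//; [move=> k u v; rewrite scalerDr !scalerA mulrC|exact: fox_loc].
rewrite (Omega_intg U a).
rewrite -[RHS]/((fun y => y * intg (fox i U) b) (intg _ a)).
rewrite -intg_comp//; first by move=> k u v; rewrite mulrDl scalerAl.
apply: (loc_const_comp (fun q => galg_of K q)).
by exists U; exact: coset_const_pi.
Qed.

Lemma Fox1 i : Fox i 1 = 0.
Proof.
apply: OmegaP => U /=; rewrite -Omega_of1 intg_of; last exact: fox_loc.
by rewrite derivation1//; exact: fox_der.
Qed.

Lemma Fox_gen i j : Fox i (Omega_of K (x j) - 1) = (j == i)%:R.
Proof.
rewrite raddfB /= Fox1 subr0; apply: OmegaP => U /=.
rewrite intg_of; last exact: fox_loc.
by rewrite fox_gen; case: (j == i).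
Qed.

Lemma Fox_sum i (b : 'I_d -> B) :
  Fox i (\sum_j b j * (Omega_of K (x j) - 1)) = b i.
Proof.
rewrite raddf_sum (bigD1 i)//= big1 ?addr0 => [|j /negbTE ji];
  rewrite FoxM raddfB /= Omega_aug_of -Omega_of1 Omega_aug_of subrr scale0r add0r.
  by rewrite Fox_gen eqxx mulr1.
by rewrite Fox_gen ji mulr0.
Qed.

(** On group elements, [g - 1] and the sum on the right are derivations with the same values at the
    generators; integrating gives the formula. Together with [Fox_sum] it says that the [x i - 1]
    form a basis of the augmentation ideal. *)
Lemma Fox_fundamental a :
  a = Omega_aug a *: 1 + \sum_i Fox i a * (Omega_of K (x i) - 1).
Proof.
apply: OmegaP => U; rewrite /= Omega_sum_comp /=.
have pl : loc_const (fun g => galg_of K (quot_pi U g)).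
  by apply: (loc_const_comp (fun q => galg_of K q)); exists U; exact: coset_const_pi.
have xl i : loc_const (fun g => fox i U g * (galg_of K (quot_pi U (x i)) - 1)).
  exact: (loc_const_comp (fun y => y * _) (fox_loc i U)).
have sl : loc_const (fun g => \sum_i fox i U g * (galg_of K (quot_pi U (x i)) - 1)).
  have [V hV] := loc_const_fam xl; exists V => g v Vv.
  by apply: eq_bigr => i _; rewrite hV.
have E g : galg_of K (quot_pi U g) =
    1 + \sum_i fox i U g * (galg_of K (quot_pi U (x i)) - 1).
  apply/eqP; rewrite addrC -subr_eq; apply/eqP.
  suff /(congr1 (fun D : F -> _ => D g)) :
    (fun g => galg_of K (quot_pi U g) - 1) =
    (fun g => \sum_i fox i U g * (galg_of K (quot_pi U (x i)) - 1)) by [].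
  apply: (derivation_unique pK xfree) => //.
  - exact: (loc_const_comp (fun y => y - 1) pl).
  - move=> a' b'; rewrite quot_piM galg_ofM mulrBr mulr1.
    by rewrite [RHS]addrC subrKA.
  - move=> a' b'; rewrite mulr_sumr -big_split; apply: eq_bigr => i _ /=.
    by rewrite fox_der mulrDl mulrA.
  - move=> j; rewrite (bigD1 j)//= big1 ?addr0 ?fox_gen ?eqxx ?mul1r// => i.
    by rewrite fox_gen eq_sym => /negbTE ->; rewrite mul0r.
rewrite (Omega_intg U a) (funext E).
rewrite intg_fun_add//; last exact: loc_const_cst.
rewrite intg_fun_sum//; congr (_ + _).
  rewrite -[RHS]/((fun k : K^o => k *: (1 : galg K (quot U))) (Omega_aug a)) -intg_comp//.
  - by congr intg; apply/funext => h /=; rewrite scale1r.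
  - by move=> k u v; rewrite scalerDl scalerA.
  - exact: loc_const_cst.
apply: eq_bigr => i _.
rewrite -[RHS]/((fun y => y * (galg_of K (quot_pi U (x i)) - 1)) (intg (fox i U) a)).
by rewrite -intg_comp//; [move=> k u v; rewrite mulrDl scalerAl|exact: fox_loc].
Qed.

(** A power of the ideal is spanned by products [a * b] whose last factor has augmentation 0, so the
    term of [FoxM] that differentiates [a] drops out and only the last factor is lost. *)
Lemma Fox_ideal_exp i n a : ideal_exp I n a -> ideal_exp I n.-1 (Fox i a).
Proof.
case: n => // n /=.
have [I0 ID _ _] := ideal_exp_two_sided (aug_ideal_two_sided K F) n.
have iI := ideal_exp_two_sided (aug_ideal_two_sided K F) n.
move: a; apply: (@ideal_mul_subset _ _ _ [set a | ideal_exp I n (Fox i a)]).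
- by rewrite /= raddf0.
- by move=> a b /= Ia Ib; rewrite raddfD; exact: ID.
- move=> a b Ia bI; have b0 : Omega_aug b = 0 by move: bI; rewrite aug_idealE.
  by rewrite /= FoxM b0 scale0r add0r; have [_ _ _ IM] := iI; exact: IM.
Qed.

Lemma coset_const_Fox i U :
  exists V, forall a : B, a V = 0 -> Fox i a U = 0.
Proof.
have [V fV] := fox_loc i U; exists V => a aV /=.
by rewrite (intgE _ fV) /coset_sum big1// => q _; rewrite aV ffunE scale0r.
Qed.

(** Openness of the powers. If [a] vanishes at a deep enough level, its augmentation is 0 and, the
    derivatives being continuous, each [Fox i a] lies in [I^n]; the Fox expansion then puts [a] in
    [I^(n+1)]. *)
Lemma ideal_exp_open n : exists V, forall a : B, a V = 0 -> ideal_exp I n a.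
Proof.
elim: n => [|n [U UI]]; first by have [V _] := openNormalT F; exists V.
have /choice[W WP] i := coset_const_Fox i U.
have [V VW] : exists V, forall i, V `<=` W i.
  suff [V VW] : exists V, forall i, i \in enum 'I_d -> V `<=` W i.
    by exists V => i; apply: VW; rewrite mem_enum.
  elim: (enum 'I_d) => [|i s [V VW]]; first by have [V _] := openNormalT F; exists V.
  have [X XE] := openNormalI V (W i); exists X => j.
  rewrite inE XE => /orP[/eqP -> ? []//|/VW]; exact: subset_trans.
exists V => a aV; rewrite (Fox_fundamental a) (Omega_augE V) aV.
rewrite [galg_aug _]big1 => [|q _]; last by rewrite ffunE.
rewrite scale0r add0r; apply: ideal_sum => [|i _].
  exact/(ideal_exp_two_sided _ n.+1)/aug_ideal_two_sided.
apply: ideal_mulP.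
  by apply/UI/WP; rewrite -(Omega_compat a (VW i)) aV galg_map0.
by rewrite aug_idealE /= raddfB /= Omega_aug_of -Omega_of1 Omega_aug_of subrr.
Qed.

End FoxDerivatives.

(** * Functoriality of the completed group algebra *)

Section OmegaMap.
Variables (K : fieldType) (F G : topGroupType) (phi : F -> G).
Hypothesis phi_hom : continuous_hom phi.

Let f (U : openNormal G) (g : F) : galg K (quot U) :=
  galg_of K (quot_pi U (phi g)).

Let f_loc U : loc_const (f U).
Proof.
have [W WE] := openNormal_preim U phi_hom; exists W => g v.
rewrite WE /f => Uv; congr galg_of; have [-> _] := phi_hom.
exact: coset_const_pi.
Qed.

Let f_compat (U V : openNormal G) g :
  U `<=` V -> galg_map (@quot_map G U V) (f U g) = f V g.
Proof. by move=> UV; rewrite galg_map_of quot_map_pi. Qed.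

Definition Omega_map : Omega K F -> Omega K G := push f_loc f_compat.

Lemma Omega_map_of g : Omega_map (Omega_of K g) = Omega_of K (phi g).
Proof. by apply: OmegaP => U /=; rewrite intg_of //; exact: f_loc. Qed.

Lemma Omega_map1 : Omega_map 1 = 1.
Proof.
rewrite -Omega_of1 Omega_map_of (_ : phi 1%g = 1%g)//.
by have [phiM _] := phi_hom; apply: (mulgI (phi 1%g)); rewrite -phiM !mulg1.
Qed.

Lemma Omega_mapM a b : Omega_map (a * b) = Omega_map a * Omega_map b.
Proof.
apply: OmegaP => U /=; rewrite intg_mul; last exact: f_loc.
have E g : intg (fun h => f U (g * h)%g) b = f U g * intg (f U) b.
  rewrite -[RHS]/((fun y => f U g * y) (intg (f U) b)) -intg_comp; last exact: f_loc.
    congr intg; apply/funext => h /=; have [phiM _] := phi_hom.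
    by rewrite /f phiM quot_piM galg_ofM.
  by move=> k u v; rewrite mulrDr scalerAr.
rewrite (funext E) -[RHS]/((fun y => y * intg (f U) b) (intg (f U) a)).
by rewrite -intg_comp//; [move=> k u v; rewrite mulrDl scalerAl|exact: f_loc].
Qed.

HB.instance Definition _ :=
  GRing.isLinear.Build K (Omega K F) (Omega K G) _ Omega_map
    (push_linear f_loc f_compat).
HB.instance Definition _ :=
  GRing.isMonoidMorphism.Build (Omega K F) (Omega K G) Omega_map
    (conj Omega_map1 Omega_mapM).

Lemma Omega_aug_map a : Omega_aug (Omega_map a) = Omega_aug a.
Proof.
have [U _] := openNormalT G; rewrite (Omega_augE U) /= /Omega_aug.
rewrite -(@intg_comp _ _ _ K^o (@galg_aug K (quot U)) (f U)); last exact: f_loc.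
  congr intg; apply/funext => g /=; rewrite /galg_aug (bigD1 (quot_pi U (phi g)))//=.
  by rewrite ffunE eqxx big1 ?addr0// => q /negbTE qg; rewrite ffunE qg.
move=> k u v; rewrite /galg_aug scaler_sumr -big_split.
by apply: eq_bigr => q _; rewrite !ffunE.
Qed.

Lemma Omega_map_preim (U : openNormal G) (V : openNormal F) a :
  openNormal_set V = phi @^-1` U ->
  Omega_map a U = \sum_(q : quot V) a V q *: f U (quot_rep q).
Proof.
move=> VE; rewrite /= (@intgE _ _ _ V)// => g v.
rewrite VE /f => Uv; congr galg_of; have [-> _] := phi_hom.
exact: coset_const_pi.
Qed.

(** As [V] is the full preimage of [U], the map [F/V -> G/U] is injective and no two coefficients of
    [a V] are added together. *)
Lemma Omega_map_eq0 (U : openNormal G) (V : openNormal F) a :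
  openNormal_set V = phi @^-1` U -> Omega_map a U = 0 -> a V = 0.
Proof.
move=> VE; rewrite (Omega_map_preim _ VE) => a0; apply/ffunP => q.
move/ffunP: a0 => /(_ (quot_pi U (phi (quot_rep q)))).
rewrite sum_ffunE (bigD1 q)//= big1 ?addr0; last first.
  move=> q' q'q; rewrite !ffunE; case: eqP => [|_]; last by rewrite scaler0.
  have [phiM _] := phi_hom.
  have phi1 : phi 1%g = 1%g by apply: (mulgI (phi 1%g)); rewrite -phiM !mulg1.
  have phiV y : phi y^-1%g = (phi y)^-1%g.
    by apply: (mulgI (phi y)); rewrite -phiM !mulgV.
  move/esym/quot_piE; rewrite -phiV -phiM -[openNormal_set U _]/((phi @^-1` U) _) -VE.
  by move/quot_piE; rewrite !quot_repK => qq; rewrite qq eqxx in q'q.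
by rewrite !ffunE eqxx /GRing.scale /= mulr1.
Qed.

End OmegaMap.

(** * Surjectivity of [Omega(F) -> Omega(G)] by compactness *)

Lemma ultra_finite_partition (X : Type) (T : finType) (D : set_system X)
    (h : X -> T) : UltraFilter D -> exists t, D (h @^-1` [set t]).
Proof.
move=> UD; apply: contrapT => nD.
have Dn t : D (~` (h @^-1` [set t])).
  by have [Dt|//] := in_ultra_setVsetC (h @^-1` [set t]) UD; case: nD; exists t.
have : D (\bigcap_(t in [set` finmap.enum_fset (fset_set [set: T])]) ~` (h @^-1` [set t])).
  by apply: filter_bigI.
move=> /filter_ex[y]; apply; last reflexivity.
by rewrite /= in_fset_set ?inE//; exact: finite_finset.
Qed.

Section Surjectivity.
Variables (K : finFieldType) (F G : topGroupType) (phi : F -> G).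
Hypotheses (phi_hom : continuous_hom phi) (phi_surj : forall g, exists x, phi x = g).

Let lift (c : Omega K G) (U : openNormal G) : Omega K F :=
  \sum_(q : quot U) c U q *: Omega_of K (projT1 (cid (phi_surj (quot_rep q)))).

Let lift_map c U : Omega_map phi_hom (lift c U) U = c U.
Proof.
rewrite /lift linear_sum Omega_sum_comp [RHS]galg_sum; apply: eq_bigr => q _.
rewrite linearZ -[LHS]/(c U q *: Omega_map phi_hom (Omega_of K _) U) Omega_map_of /=.
by case: cid => /= y ->; rewrite quot_repK.
Qed.

Let lift_map_sub c (U V : openNormal G) :
  U `<=` V -> Omega_map phi_hom (lift c U) V = c V.
Proof. by move=> UV; rewrite -(Omega_compat _ UV) lift_map Omega_compat. Qed.

(* A limit of lifts of the components along an ultrafilter refining the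
   filter of small open normal subgroups. *)
Lemma Omega_map_surj (c : Omega K G) : exists a, Omega_map phi_hom a = c.
Proof.
pose N := filter_from [set: openNormal G] (fun U => [set V : openNormal G | V `<=` U]).
have NF : ProperFilter N.
  apply: filter_from_proper; last by move=> U _; exists U => /=.
  apply: filter_from_filter; first by have [U _] := openNormalT G; exists U.
  move=> U V _ _; have [W WE] := openNormalI U V; exists W => // X /= XW.
  by split => y /XW; rewrite WE => -[].
have [D [UD ND]] := ultraFilterLemma NF.
(* Finiteness of [K] enters here: the [V]-component of a lift has finitely many possible values, so
   one of them is taken on a member of [D]. *)
have eD (V : openNormal F) : exists t : {ffun quot V -> K},
    D [set U | lift c U V = t].
  exact: (@ultra_finite_partition _ {ffun quot V -> K} D (fun U => lift c U V)).
pose e V : galg K (quot V) := projT1 (cid (eD V)).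
have eP V : D [set U | lift c U V = e V] := projT2 (cid (eD V)).
have ec : @compatible K F e.
  move=> U V UV; have /filter_ex[X [/= XU XV]] :
    D ([set X | lift c X U = e U] `&` [set X | lift c X V = e V]).
    by apply: filterI; exact: eP.
  by rewrite -XU -XV Omega_compat.
exists (MkOmega ec); apply: OmegaP => U.
have [V VE] := openNormal_preim U phi_hom.
have /filter_ex[X [/= XV XU]] : D ([set X | lift c X V = e V] `&` [set X | X `<=` U]).
  by apply: filterI; [exact: eP|apply: ND; exists U].
rewrite -(lift_map_sub c XU) -[LHS]/(Omega_map phi_hom (MkOmega ec) U).
rewrite (Omega_map_preim phi_hom (MkOmega ec) VE).
by rewrite (Omega_map_preim phi_hom (lift c X) VE) XV.
Qed.

End Surjectivity.

(** * The kernel of [Omega(F) -> Omega(G)] *)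

Section Kernel.
Variables (K : finFieldType) (p : nat) (F G : topGroupType) (d r : nat).
Variables (x : 'I_d -> F) (phi : F -> G) (rel : 'I_r -> F).
Hypotheses (pK : p.-nat #|K|) (xfree : free_pro_p_on p x).
Hypotheses (G_hausdorff : hausdorff_space G) (phi_hom : continuous_hom phi).
Hypothesis phi_surj : forall g, exists y, phi y = g.
Hypothesis phi_ker : phi @^-1` [set 1%g] = closed_normal_closure (range rel).
Notation Phi := (Omega_map (K := K) phi_hom).

(** Since [V] contains the kernel, the complement of [phi(V)] is the image of the compact complement
    of [V]. It is closed because [G] is Hausdorff, so [phi(V)] is open. *)
Lemma open_image_kernel (V : openNormal F) : phi @^-1` [set 1%g] `<=` V ->
  exists U : openNormal G, openNormal_set V = phi @^-1` U.
Proof.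
move=> kV; have [V1 VM VV VJ] := openNormal_normal V.
have [phiM phiC] := phi_hom.
have phi1 : phi 1%g = 1%g by apply: (mulgI (phi 1%g)); rewrite -phiM !mulg1.
have phiV y : phi y^-1%g = (phi y)^-1%g.
  by apply: (mulgI (phi y)); rewrite -phiM !mulgV.
have VE : openNormal_set V = phi @^-1` (phi @` V).
  apply/seteqP; split=> [v Vv|y /= [v Vv vy]]; first by exists v.
  rewrite -(mulVKg v y); apply: VM => //; apply: kV => /=.
  by rewrite phiM phiV vy mulVg.
suff [U UE] : exists U : openNormal G, openNormal_set U = phi @` V.
  by exists U; rewrite UE.
have /choice[s sK] := phi_surj.
apply: (@openNormal_exists _ _ (quot V) (fun g => quot_pi V (s g))).
- rewrite -closedC (_ : ~` _ = phi @` (~` V)).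
    apply: compact_closed => //; apply: continuous_compact.
      exact: continuous_subspaceT.
    have [[[Fc _ _] _] _] := xfree.
    apply: subclosed_compact Fc _ => //.
    exact/open_closedC/openNormal_open.
  apply/seteqP; split=> [g|_ [y nVy <-]].
    by have [y <-] := phi_surj g => ng; exists y => // Vy; apply: ng; exists y.
  by move=> gV; apply: nVy; rewrite VE.
- split.
  + by exists 1%g.
  + by move=> _ _ [u Vu <-] [v Vv <-]; exists (u * v)%g; [exact: VM|rewrite phiM].
  + by move=> _ [u Vu <-]; exists u^-1%g; [exact: VV|rewrite phiV].
  + move=> _ g [u Vu <-]; have [y <-] := phi_surj g.
    by exists (u ^ y)%g; [exact: VJ|rewrite /conjg !phiM phiV].
- move=> g h /quot_piE Vgh; exists ((s g)^-1 * s h)%g => //.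
  by rewrite phiM phiV !sK.
Qed.

(** The [rel j - 1] generate the kernel of [Phi] only topologically, hence the restriction to an
    ideal [E] containing a power of [I], which makes it open. The [g] with [g - 1] in [E] then form
    an open, hence closed, normal subgroup; it contains the relators and therefore the kernel of
    [phi]. *)
Lemma Omega_map_kernel (E : set (Omega K F)) n :
  two_sided_ideal E -> ideal_exp (@aug_ideal K F) n `<=` E ->
  (forall j, E (Omega_of K (rel j) - 1)) -> forall a, Phi a = 0 -> E a.
Proof.
move=> iE IE relE a a0; have [E0 ED EMl EMr] := iE.
have [V0 V0P] := ideal_exp_open pK xfree n.
pose N := [set g | E (Omega_of K g - 1)].
have V0N : V0 `<=` N.
  move=> g V0g; apply/IE/V0P; rewrite /= (_ : quot_pi V0 g = quot_pi V0 1%g) ?subrr//.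
  apply/esym/quot_piE; by rewrite invg1 mul1g.
have nN : normal_subgroup N.
  rewrite /N; split=> /= [|g h Eg Eh|g Eg|g h Eg].
  - by rewrite Omega_of1 subrr.
  - rewrite Omega_ofM (_ : _ - 1 = Omega_of K g * (Omega_of K h - 1) + (Omega_of K g - 1)).
      by apply: ED => //; exact: EMl.
    by rewrite mulrBr mulr1 subrKA.
  - rewrite (_ : _ - 1 = - (Omega_of K g^-1%g * (Omega_of K g - 1))).
      by apply: (ideal_opp iE); exact: EMl.
    by rewrite mulrBr -Omega_ofM mulVg mulr1 opprB.
  - rewrite (_ : _ - 1 = Omega_of K h^-1%g * (Omega_of K g - 1) * Omega_of K h).
      by apply: EMr; exact: EMl.
    by rewrite mulrBr mulr1 mulrBl -!Omega_ofM mulVg /conjg mulgA.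
have kN : phi @^-1` [set 1%g] `<=` N.
  rewrite phi_ker => g; apply => //; first exact: open_subgroup_closed V0N.
  by move=> _ [j _ <-]; exact: relE.
have [V VE] := openNormal_super nN V0N.
have [U VU] : exists U : openNormal G, openNormal_set V = phi @^-1` U.
  by apply: open_image_kernel; rewrite VE.
have aV : a V = 0 by apply: (Omega_map_eq0 (phi_hom := phi_hom) VU); rewrite a0.
(* A finite combination of group elements with the same [V0]-component as [a], so that [a - a1] lies
   in [E]. *)
pose a1 := \sum_(q : quot V0) a V0 q *: Omega_of K (quot_rep q).
have a1E : a1 V0 = a V0.
  rewrite /a1 Omega_sum_comp [RHS]galg_sum; apply: eq_bigr => q _ /=.
  by rewrite quot_repK.
(* One representative for each coset of [V]. After regrouping, the coefficients of [a2] are those of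
   [a V], hence 0; each exchange of representatives costs a multiple of some [g - 1] with [g] in
   [V], hence an element of [E]. *)
pose v q := quot_rep (@quot_map F V0 V q).
pose a2 := \sum_(q : quot V0) a V0 q *: Omega_of K (v q).
have a20 : a2 = 0.
  rewrite /a2 (partition_big (@quot_map F V0 V) predT)//= big1// => q _.
  rewrite (eq_bigr (fun i => a V0 i *: Omega_of K (quot_rep q))); last first.
    by move=> i /eqP iq; rewrite /v iq.
  have V0V : V0 `<=` V by rewrite VE.
  rewrite -scaler_suml; move: aV; rewrite -(Omega_compat a V0V).
  by move=> /ffunP/(_ q); rewrite !ffunE => ->; rewrite scale0r.
have -> : a = (a - a1) + (a1 - a2) by rewrite a20 subr0 subrK.
apply: ED.
  apply/IE/V0P.
  by rewrite -[LHS]/(a V0 - a1 V0) a1E subrr.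
rewrite /a1 /a2 -sumrB; apply: ideal_sum => // q _.
rewrite -scalerBr -[X in _ *: X]mul1r scalerAl; apply: (EMl).
rewrite (_ : _ - _ = Omega_of K (v q) * (Omega_of K ((v q)^-1 * quot_rep q)%g - 1)).
  apply: EMl; rewrite -[E _]/(N _) -VE; apply/quot_piE.
  rewrite /v quot_repK -[in LHS](quot_repK q) quot_map_pi//.
  by rewrite VE.
by rewrite mulrBr mulr1 -Omega_ofM mulVKg.
Qed.

End Kernel.

(** * Dimension counting *)

Section Index.
Variable V : zmodType.
Implicit Types A B C : set V.

(** Over a finite field the index is the cardinality of the field raised to the dimension, so
    dimension inequalities can be read off from injections of finite sets. *)
Definition has_index A B (N : nat) : Prop :=
  exists (T : finType) (v : T -> V),
    [/\ #|T| = N, forall i, A (v i) & forall x, A x -> exists! i, B (x - v i)].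

Lemma has_index_refl A : A 0 -> (forall x, A x -> A (x - 0)) -> has_index A A 1.
Proof.
move=> A0 AD; exists unit, (fun=> 0); split=> //; first exact: card_unit.
by move=> x Ax; exists tt; split=> [|[]//]; exact: AD.
Qed.

Lemma has_index_mul A B C M N :
  (forall x y, A x -> A y -> A (x + y)) ->
  (forall x y, B x -> B y -> B (x + y)) ->
  C `<=` B -> B `<=` A ->
  has_index A B M -> has_index B C N -> has_index A C (M * N).
Proof.
move=> AD BD CB BA [S [v [cS vA vP]]] [T [w [cT wB wP]]].
exists (S * T)%type, (fun st => v st.1 + w st.2); split.
- by rewrite card_prod cS cT.
- by move=> i; apply: AD => //; exact/BA.
move=> x Ax; have [s [sx su]] := vP _ Ax; have [t [tx tu]] := wP _ sx.
exists (s, t); split=> /= [|[s' t'] /= Cx]; first by rewrite opprD addrA.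
have E : s = s'.
  apply: su; rewrite -(subrK (w t') (x - v s')).
  by apply: BD => //; apply: CB; rewrite -addrA -opprD.
by subst s'; congr pair; apply: tu; rewrite -addrA -opprD.
Qed.

End Index.

Lemma has_quot_dim_index (K : finFieldType) (V : lmodType K) (A B : set V) n :
  (forall (k : K) x, A x -> A (k *: x)) -> (forall x y, A x -> A y -> A (x + y)) ->
  A 0 -> has_quot_dim A B n -> has_index A B (#|K| ^ n).
Proof.
move=> AZ AD A0 [v [vA vP]]; exists 'rV[K]_n, (fun c : 'rV[K]_n => \sum_i c 0 i *: v i).
split=> [|c|//]; first by rewrite card_mx mul1n.
by elim/big_rec : _ => // i x _ Ax; apply: AD => //; exact: AZ.
Qed.

Lemma has_quot_dim_exists (K : finFieldType) (V : lmodType K) (A B : set V)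
    (T : finType) (g : T -> V) :
  A 0 -> B 0 -> (forall x y, B x -> B y -> B (x + y)) ->
  (forall (k : K) x, B x -> B (k *: x)) ->
  (forall x, A x -> exists t, B (x - g t)) ->
  (forall x y, A x -> A y -> A (x + y)) -> B `<=` A ->
  exists n, has_quot_dim A B n.
Proof.
move=> A0 B0 BD BZ gP AD BA.
have BN x : B x -> B (- x) by rewrite -scaleN1r; exact: BZ.
pose spanning n := exists v : 'I_n -> V, (forall i, A (v i)) /\
  forall x, A x -> exists c : 'rV[K]_n, B (x - \sum_i c 0 i *: v i).
have ex : exists n, `[< spanning n >].
  exists #|T|; apply/asboolP.
  (* The points [g t] need not lie in [A]; each is replaced by an element of [A] in its coset of
     [B], or by 0 if there is none. *)
  have /choice[v vP] (i : 'I_#|T|) : exists y, A y /\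
      ((exists2 x, A x & B (x - g (enum_val i))) -> B (y - g (enum_val i))).
    have [[x Ax Bx]|nx] := pselect (exists2 x, A x & B (x - g (enum_val i))).
      by exists x.
    by exists 0.
  exists v; split=> [i|x Ax]; first by have [] := vP i.
  have [t Bt] := gP x Ax; exists (delta_mx 0 (enum_rank t)).
  rewrite (bigD1 (enum_rank t))//= big1 => [|i /negbTE it]; last first.
    by rewrite mxE it andbF scale0r.
  rewrite mxE !eqxx scale1r addr0 -(subrKA (g t)); apply: BD => //.
  rewrite -opprB; apply: BN; have [_] := vP (enum_rank t).
  by rewrite enum_rankK; apply; exists x.
have := ex_minnP ex; case=> n /asboolP[v [vA vP]] nmin.
exists n, v; split=> // x Ax; have [c cP] := vP _ Ax; exists c; split=> // c' cP'.
apply/eqP; rewrite -subr_eq0; apply: contraT => /rV0Pn[k].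
set e := c - c' => ek.
have Be : B (\sum_i e 0 i *: v i).
  rewrite (_ : \sum_i _ = (x - \sum_i c' 0 i *: v i) - (x - \sum_i c 0 i *: v i)).
    by apply: BD => //; exact: BN.
  rewrite opprB addrC subrKA -sumrB; apply: eq_bigr => i _.
  by rewrite -scalerBl !mxE.
clear x Ax cP cP'.
case: n v vA vP nmin c c' k e ek Be => [|n] v vA vP nmin c c' k e ek Be.
  by case: k ek.
suff /asboolP/nmin : spanning n by rewrite ltnn.
exists (v \o lift k); split=> [i|x Ax]; first exact: vA.
have [b bP] := vP _ Ax.
(* This multiple of the relation cancels the [k]-th coordinate. *)
pose b' := b - (b 0 k / e 0 k) *: e.
exists (\row_i b' 0 (lift k i)).
rewrite (_ : x - _ = (x - \sum_i b 0 i *: v i)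
    + (b 0 k / e 0 k) *: \sum_i e 0 i *: v i).
  by apply: BD => //; exact: BZ.
have -> : \sum_i (\row_i0 b' 0 (lift k i0)) 0 i *: (v \o lift k) i =
    \sum_i b' 0 i *: v i.
  rewrite [RHS](bigD1_ord k)//= !mxE divfK// subrr scale0r add0r.
  by apply: eq_bigr => i _; rewrite mxE.
rewrite -addrA; congr (_ + _); rewrite scaler_sumr -!sumrN -big_split.
by apply: eq_bigr => i _; rewrite /= !mxE scalerBl opprB addrC scalerA.
Qed.

Section IndexCount.
Variables (A : pzRingType) (I : set A) (d r n : nat).
Variables (z : 'I_d -> A) (w : 'I_d -> 'I_r -> A).
Variables (N M : nat) (L m : 'I_r -> nat).
Hypotheses (iI : two_sided_ideal I) (zI : forall i, I (z i)).
Hypothesis relations : forall u : 'I_d -> A,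
  ideal_exp I n.+1 (\sum_i u i * z i) ->
  exists t : 'I_r -> A, forall i, ideal_exp I n (u i - \sum_j t j * w i j).
Hypothesis w_depth : forall i j a,
  ideal_exp I (m j) a -> ideal_exp I n (a * w i j).
Hypothesis indexN : has_index setT (ideal_exp I n) N.
Hypothesis indexM : has_index I (ideal_exp I n.+1) M.
Hypothesis indexL : forall j, has_index setT (ideal_exp I (m j)) (L j).

(* Up to the choice of one solution [u0] of [\sum_i u i * z i = y] for each [y],
   the vector [u] is determined modulo [I^n] by [y] modulo [I^(n+1)] and by the
   coefficients [t j] modulo [I^(m j)]. *)
Lemma index_count : (N ^ d <= M * \prod_j L j)%N.
Proof.
have [T [v [cT _ vP]]] := indexN; have [W [y [cW yI yP]]] := indexM.
pose S j : finType := projT1 (cid (indexL j)).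
pose s j : S j -> A := projT1 (cid (projT2 (cid (indexL j)))).
have sP j : [/\ #|S j| = L j, forall i, [set: A] (s j i) &
    forall x, [set: A] x -> exists! i, ideal_exp I (m j) (x - s j i)].
  exact: (projT2 (cid (projT2 (cid (indexL j))))).
have [I0 ID IMl IMr] := ideal_exp_two_sided iI n.
have iIn := ideal_exp_two_sided iI n.
have iIn1 := ideal_exp_two_sided iI n.+1.
have /choice[u0 u0P] (c : W) : exists u0 : 'I_d -> A,
    (exists u : 'I_d -> A, ideal_exp I n.+1 (\sum_i u i * z i - y c)) ->
    ideal_exp I n.+1 (\sum_i u0 i * z i - y c).
  have [[u uc]|nu] := pselect (exists u : 'I_d -> A,
    ideal_exp I n.+1 (\sum_i u i * z i - y c)); first by exists u.
  by exists (fun=> 0).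
have /choice[g gP] (u : {ffun 'I_d -> T}) : exists c : W * {dffun forall j, S j},
    forall i, ideal_exp I n (v (u i) - u0 c.1 i - \sum_j s j (c.2 j) * w i j).
  have [|c [cP _]] := yP (\sum_i v (u i) * z i).
    by apply: ideal_sum => // i _; have [_ _ IM _] := iI; exact: IM.
  have u0c : ideal_exp I n.+1 (\sum_i u0 c i * z i - y c).
    by apply: u0P; exists (v \o u).
  have [|t tP] := relations (u := fun i => v (u i) - u0 c i).
    rewrite (_ : \sum_i _ = (\sum_i v (u i) * z i - y c) -
      (\sum_i u0 c i * z i - y c)); first exact: ideal_sub.
    rewrite opprB subrKA -sumrB.
    by apply: eq_bigr => i _; rewrite mulrBl.
  pose tau : {dffun forall j, S j} :=
    [ffun j => projT1 (cid (let: And3 _ _ h := sP j in h (t j) Logic.I))].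
  have tauP j : ideal_exp I (m j) (t j - s j (tau j)).
    by rewrite ffunE; case: cid => ? [].
  exists (c, tau) => i /=.
  rewrite (_ : _ - _ = (v (u i) - u0 c i - \sum_j t j * w i j) +
    \sum_j (t j - s j (tau j)) * w i j).
    by apply: ID => //; apply: ideal_sum => // j _; exact: w_depth.
  rewrite -[RHS]addrA; congr (_ + _); rewrite -[LHS](addKr (\sum_j t j * w i j)).
  by rewrite -sumrB; congr (_ + _); apply: eq_bigr => j _; rewrite mulrBl.
have ginj : injective g.
  move=> u u' guu'; apply/ffunP => i.
  (* Modulo [I^n] both entries equal the one rebuilt from the common code, so uniqueness of
     representatives applies. *)
  have := ideal_sub iIn (gP u i) (gP u' i); rewrite guu' opprB addrA subrK.
  rewrite opprB addrA subrK => vuu.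
  have [c [_ cu]] := vP (v (u i)) Logic.I.
  by rewrite -(cu _ vuu) -(cu (u i))// subrr.
have := leq_card g ginj.
rewrite card_ffun card_ord cT card_prod cW card_dep_ffun foldrE big_image /=.
by rewrite (eq_bigr L)// => j _; have [] := sP j.
Qed.

End IndexCount.

(** * The Golod-Shafarevich inequality *)

Section GolodShafarevich.
Variables (K : finFieldType) (p : nat) (F G : topGroupType) (d r : nat).
Variables (x : 'I_d -> F) (phi : F -> G) (rel : 'I_r -> F).
Hypotheses (pK : p.-nat #|K|) (xfree : free_pro_p_on p x).
Hypotheses (G_hausdorff : hausdorff_space G) (phi_hom : continuous_hom phi).
Hypothesis phi_surj : forall g, exists y, phi y = g.
Hypothesis phi_ker : phi @^-1` [set 1%g] = closed_normal_closure (range rel).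
Notation Phi := (Omega_map (K := K) phi_hom).
Notation I := (@aug_ideal K F).
Notation J := (@aug_ideal K G).

Let iI := aug_ideal_two_sided K F.
Let iJ := aug_ideal_two_sided K G.

Let Phi_ideal a : I a <-> J (Phi a).
Proof. by rewrite !aug_idealE /= Omega_aug_map. Qed.

Let Phi_surj b : exists a, Phi a = b := Omega_map_surj phi_hom phi_surj b.

(** The Fox Jacobian, or Alexander matrix, of the presentation over [Omega(G)]. *)
Definition relator_coef (i : 'I_d) (j : 'I_r) : Omega K G :=
  Phi (Fox pK xfree i (Omega_of K (rel j) - 1)).

(** The elements of [Omega(F)] for which the conclusion holds form an open two-sided ideal [E]
    containing the [rel j - 1], hence the kernel of [Phi]. A lift [e] of the given sum differs from
    an element of [I^(n+1)] by an element of this kernel, and its Fox derivatives are the lifts of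
    the [u i]. *)
Lemma relations_module n (u : 'I_d -> Omega K G) :
  ideal_exp J n.+1 (\sum_i u i * (Omega_of K (phi (x i)) - 1)) ->
  exists t : 'I_r -> Omega K G,
    forall i, ideal_exp J n (u i - \sum_j t j * relator_coef i j).
Proof.
move=> uJ; have iJn := ideal_exp_two_sided iJ n.
have iJn1 := ideal_exp_two_sided iJ n.+1.
have [J0 JD JMl JMr] := iJn; have [J0' JD' JMl' JMr'] := iJn1.
have JS := ideal_expS_sub iJ (n := n).
pose E := [set e : Omega K F | ideal_exp J n.+1 (Phi e) /\
  exists t : 'I_r -> Omega K G,
    forall i, ideal_exp J n (Phi (Fox pK xfree i e) - \sum_j t j * relator_coef i j)].
have JZ (k : K) y : ideal_exp J n y -> ideal_exp J n (k *: y).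
  by rewrite -[y in _ *: y]mul1r scalerAl; exact: JMl.
have iE : two_sided_ideal E.
  split.
  - split; first by rewrite raddf0.
    exists (fun=> 0) => i; rewrite raddf0 raddf0 big1 ?subrr// => j _.
    by rewrite mul0r.
  - move=> e e' [Je [t te]] [Je' [t' te']]; split.
      by rewrite raddfD; exact: JD'.
    exists (fun j => t j + t' j) => i.
    rewrite raddfD raddfD (eq_bigr (fun j => t j * relator_coef i j +
      t' j * relator_coef i j)); last by move=> j _; rewrite mulrDl.
    by rewrite big_split /= opprD addrACA; exact: (JD _ _ (te i) (te' i)).
  (* For left multiples the first clause of [E] forces [Omega_aug e = 0], which removes the
     derivative of [a]. *)
  - move=> a e [Je [t te]]; split; first by rewrite rmorphM; exact: JMl'.
    have e0 : Omega_aug e = 0.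
      have : J (Phi e) by rewrite -(ideal_exp1 iJ); exact: (ideal_exp_le iJ (ltn0Sn n) Je).
      by rewrite aug_idealE /= Omega_aug_map.
    exists (fun j => Phi a * t j) => i.
    rewrite FoxM e0 scale0r add0r rmorphM.
    rewrite (eq_bigr (fun j => Phi a * (t j * relator_coef i j))).
      by rewrite -mulr_sumr -mulrBr; exact/JMl/te.
    by move=> j _; rewrite mulrA.
  (* For right multiples the extra term [e * Fox a] is mapped into [J^n] by the first clause of
     [E]. *)
  - move=> a e [Je [t te]]; split; first by rewrite rmorphM; exact: JMr'.
    exists (fun j => Omega_aug a *: t j) => i.
    rewrite FoxM raddfD /= linearZ rmorphM /=.
    rewrite (eq_bigr (fun j => Omega_aug a *: (t j * relator_coef i j))).
      rewrite addrAC -scaler_sumr -scalerBr; apply: JD; first exact/JZ/te.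
      by apply: JMr; exact: JS.
    by move=> j _; rewrite scalerAl.
have IE : ideal_exp I n.+1 `<=` E.
  move=> e Ie; split; first exact: (ideal_exp_image Phi_ideal).
  exists (fun=> 0) => i; rewrite big1 ?subr0; last by move=> j _; rewrite mul0r.
  by apply: (ideal_exp_image Phi_ideal); exact: (@Fox_ideal_exp _ _ _ _ _ pK xfree i n.+1).
have relE j : E (Omega_of K (rel j) - 1).
  have rel1 : phi (rel j) = 1%g.
    rewrite -[_ = _]/((phi @^-1` [set 1%g]) (rel j)) phi_ker => N _ _; apply.
    by exists j.
  split; first by rewrite raddfB /= Omega_map_of Omega_map1 rel1 Omega_of1 subrr.
  exists (fun k => (k == j)%:R) => i; rewrite (bigD1 j)//= big1 => [|k /negbTE ->].
    by rewrite eqxx mul1r addr0 subrr.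
  by rewrite mul0r.
have /choice[b bP] i : exists b, Phi b = u i by exact: Phi_surj.
pose e := \sum_i b i * (Omega_of K (x i) - 1).
have Phie : Phi e = \sum_i u i * (Omega_of K (phi (x i)) - 1).
  rewrite raddf_sum; apply: eq_bigr => i _.
  by rewrite /= Omega_mapM bP raddfB /= Omega_map1 Omega_map_of.
have [a Ia ae] := ideal_exp_lift Phi_surj Phi_ideal uJ.
have Eea : E (e - a).
  apply: (Omega_map_kernel pK xfree G_hausdorff phi_surj phi_ker iE IE relE).
  by rewrite raddfB /= ae Phie subrr.
have [_ ED _ _] := iE.
have [_ [t tP]] : E e by rewrite -(subrK a e); apply: ED => //; exact: IE.
by exists t => i; have := tP i; rewrite /e Fox_sum bP.
Qed.

Lemma relator_coef_depth n j i a :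
  ideal_exp I n (Omega_of K (rel j) - 1) -> forall m,
  ideal_exp J (m.+1 - n) a -> ideal_exp J m (a * relator_coef i j).
Proof.
(* The two exponents add up to [m] when [1 <= n <= m + 1]; otherwise truncated subtraction makes the
   sum larger. *)
move=> In m Ja; apply: (@ideal_exp_le _ _ iJ m (m.+1 - n + n.-1)).
  by case: n {In Ja} => [|n]; lia.
apply: ideal_exp_add => //; apply: (ideal_exp_image Phi_ideal).
exact: Fox_ideal_exp.
Qed.

Lemma ideal_exp_finite n : exists (T : finType) (g : T -> Omega K G),
  forall y, exists t, ideal_exp J n (y - g t).
Proof.
have [V VP] := ideal_exp_open pK xfree n.
exists {ffun quot V -> K}, (fun e : {ffun quot V -> K} =>
  Phi (\sum_q e q *: Omega_of K (quot_rep q))).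
move=> y; have [a <-] := Phi_surj y; exists (a V : {ffun quot V -> K}).
rewrite -raddfB; apply: (ideal_exp_image Phi_ideal); apply: VP.
rewrite -[LHS]/(a V - (\sum_q a V q *: Omega_of K (quot_rep q)) V).
rewrite Omega_sum_comp {1}[a V]galg_sum -sumrB big1// => q _ /=.
by rewrite quot_repK subrr.
Qed.

Let JZ n (k : K) y : ideal_exp J n y -> ideal_exp J n (k *: y).
Proof.
have [_ _ JMl _] := ideal_exp_two_sided iJ n.
by rewrite -[y in _ *: y]mul1r scalerAl; exact: JMl.
Qed.

(** The quotient is finite because the powers of [I] are open, so the junk value of [quot_dim] does
    not interfere. *)
Lemma quot_dim_ideal_exp n :
  has_quot_dim (ideal_exp J n) (ideal_exp J n.+1)
    (quot_dim (ideal_exp J n) (ideal_exp J n.+1)).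
Proof.
have [J0 JD _ _] := ideal_exp_two_sided iJ n.
have [J0' JD' _ _] := ideal_exp_two_sided iJ n.+1.
have [T [g gP]] := ideal_exp_finite n.+1.
rewrite /quot_dim; apply: (xgetPex 0%N).
apply: (@has_quot_dim_exists _ _ _ _ T g) => //.
- exact: (@JZ n.+1).
- exact: ideal_expS_sub.
Qed.

Definition graded_dim n : nat :=
  if n is 0%N then 1%N else quot_dim (ideal_exp J n) (ideal_exp J n.+1).

Lemma graded_index n :
  has_index (ideal_exp J n) (ideal_exp J n.+1) (#|K| ^ graded_dim n).
Proof.
case: n => [|n]; last first.
  have [J0 JD _ _] := ideal_exp_two_sided iJ n.+1.
  by apply: has_quot_dim_index => //; [exact: (@JZ n.+1)|exact: quot_dim_ideal_exp].
(* The convention [c_0 = 1] is the true dimension: the augmentation identifies [Omega(G)/J] with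
   [K]. *)
rewrite ideal_exp1//; exists K, (fun k => k *: 1); split=> [||y _].
- by rewrite expn1.
- by [].
have aug1 : Omega_aug (1 : Omega K G) = 1 by rewrite -Omega_of1 Omega_aug_of.
have E k : J (y - k *: 1) <-> Omega_aug y = k.
  rewrite aug_idealE /= raddfB /= linearZ /= aug1 /GRing.scale /= mulr1.
  by split=> [/eqP|->]; rewrite ?subrr// subr_eq0 => /eqP.
by exists (Omega_aug y); split=> [|k]; rewrite E.
Qed.

(** By telescoping, the dimension of [Omega(G)/J^n]. *)
Definition graded_sum n : nat := (\sum_(k < n) graded_dim k)%N.

Lemma ideal_exp_index m n :
  has_index (ideal_exp J m) (ideal_exp J (m + n))
    (#|K| ^ (\sum_(m <= k < m + n) graded_dim k)).
Proof.
have jJ k := ideal_exp_two_sided iJ k.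
elim: n => [|n IHn].
  have [J0 _ _ _] := jJ m; rewrite addn0 big_geq// expn0.
  by apply: has_index_refl => // y; rewrite subr0.
rewrite addnS big_nat_recr ?leq_addr//= expnD.
have [_ JD _ _] := jJ m; have [_ JD' _ _] := jJ (m + n)%N.
apply: (has_index_mul JD JD' _ _ IHn (graded_index _)).
- exact: ideal_expS_sub.
- by apply: ideal_exp_le => //; exact: leq_addr.
Qed.

(** The sums over the generators lie in [J], and [J/J^(n+1)] has dimension one less than
    [Omega(G)/J^(n+1)]: this is the 1 on the left. The weights [w] have to bound the depths only
    from below. *)
Lemma golod_shafarevich_dim (w : 'I_r -> option nat) n :
  (forall j, if w j is Some k then ideal_exp I k (Omega_of K (rel j) - 1)
    else rel j = 1%g) ->
  (1 + d * graded_sum n <= graded_sum n.+1 +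
    \sum_j (if w j is Some k then graded_sum (n.+1 - k) else 0))%N.
Proof.
move=> wP; pose m j := if w j is Some k then (n.+1 - k)%N else 0%N.
have jJ k := ideal_exp_two_sided iJ k.
have idx k : has_index setT (ideal_exp J k) (#|K| ^ graded_sum k).
  by have := ideal_exp_index 0 k; rewrite add0n big_mkord.
have idx1 : has_index J (ideal_exp J n.+1) (#|K| ^ (\sum_(1 <= k < n.+1) graded_dim k)).
  by have := ideal_exp_index 1 n; rewrite add1n ideal_exp1.
have zJ i : J (Omega_of K (phi (x i)) - 1).
  rewrite aug_idealE /= raddfB /= -Omega_of1 !Omega_aug_of; exact: subrr.
have wJ i j a : ideal_exp J (m j) a -> ideal_exp J n (a * relator_coef i j).
  rewrite /m; have := wP j; case: (w j) => [k relk|rel1 _].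
    exact: relator_coef_depth.
  (* A trivial relator gives a zero column, so its coefficient matters only modulo [J^0], the whole
     algebra, and counts for nothing. *)
  rewrite /relator_coef rel1 Omega_of1 subrr !raddf0 mulr0.
  by have [] := jJ n.
have := index_count iJ zJ (@relations_module n) wJ (idx n) idx1 (fun j => idx (m j)).
rewrite -expnM -expn_sum -expnD leq_exp2l ?card_finRing_gt1// mulnC => le1.
have -> : graded_sum n.+1 = (1 + \sum_(1 <= k < n.+1) graded_dim k)%N.
  by rewrite /graded_sum -(big_mkord predT graded_dim) [LHS]big_ltn.
rewrite -addnA leq_add2l; apply: leq_trans le1 _.
rewrite leq_add2l; apply: leq_sum => j _.
by rewrite /m; case: (w j) => //; rewrite /graded_sum big_ord0.
Qed.

End GolodShafarevich.

(** * Growth rates *)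

Section GrowthRate.
Variable R : realType.
Implicit Types (t q : R) (c s : nat -> nat).

(** For [n < k] truncated subtraction returns [s 0], which must be 0 for the shift to agree with
    multiplication by [t ^+ k]. *)
Lemma shifted_sum_le s t k N : 0 <= t -> s 0%N = 0%N ->
  \sum_(n < N) (s (n - k)%N)%:R * t ^+ n <= t ^+ k * \sum_(n < N) (s n)%:R * t ^+ n.
Proof.
move=> t0 s0; elim: k N => [|k IHk] N.
  rewrite expr0 mul1r le_eqVlt (eq_bigr (fun n : 'I_N => (s n)%:R * t ^+ n)) ?eqxx//.
  by move=> n _; rewrite subn0.
case: N => [|N]; first by rewrite !big_ord0 mulr0.
rewrite big_ord_recl /= sub0n s0 mul0r add0r.
rewrite (eq_bigr (fun n : 'I_N => t * ((s (n - k)%N)%:R * t ^+ n))); last first.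
  by move=> n _; rewrite /bump /= add1n subSS exprS mulrCA.
rewrite -mulr_sumr exprS -mulrA ler_wpM2l//.
apply: le_trans (IHk N) _; rewrite ler_wpM2l ?exprn_ge0//.
by rewrite big_ord_recr /= lerDl mulr_ge0 ?exprn_ge0.
Qed.

Lemma gs_sum_lower_bound s t d r (w : 'I_r -> option nat) N :
  0 < t -> s 0%N = 0%N ->
  1 - d%:R * t + \sum_(j < r) (if w j is Some k then t ^+ k else 0) < 0 ->
  (forall n, (1 + d * s n <= s n.+1 +
     \sum_j (if w j is Some k then s (n.+1 - k) else 0))%N) ->
  (0 < N)%N -> 1 <= d%:R * ((s N)%:R * t ^+ N).
Proof.
move=> t0 s0 neg le_s N0; have t0' := ltW t0.
pose S M : R := \sum_(n < M) (s n)%:R * t ^+ n.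
have S0 M : 0 <= S M by apply: sumr_ge0 => n _; rewrite mulr_ge0 ?exprn_ge0.
pose W : R := \sum_(j < r) (if w j is Some k then t ^+ k else 0).
have step n : t ^+ n.+1 + d%:R * t * ((s n)%:R * t ^+ n) <=
    (s n.+1)%:R * t ^+ n.+1 +
    \sum_j (if w j is Some k then (s (n.+1 - k)%N)%:R * t ^+ n.+1 else 0).
  have := le_s n; rewrite -(ler_nat R) natrD natrD natrM natr_sum => le_n.
  have -> : t ^+ n.+1 + d%:R * t * ((s n)%:R * t ^+ n) =
      (1 + d%:R * (s n)%:R) * t ^+ n.+1 by rewrite exprS; ring.
  apply: le_trans (ler_wpM2r (exprn_ge0 _ t0') le_n) _.
  rewrite mulrDl lerD2l mulr_suml; apply: ler_sum => j _.
  by case: (w j) => //; rewrite mul0r.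
have : \sum_(n < N) (t ^+ n.+1 + d%:R * t * ((s n)%:R * t ^+ n)) <=
    S N.+1 + W * S N.+1.
  apply: le_trans (ler_sum _ (fun (i : 'I_N) _ => step i)) _.
  rewrite big_split /=; apply: lerD.
    by rewrite /S big_ord_recl /= s0 mul0r add0r.
  rewrite exchange_big /W mulr_suml; apply: ler_sum => j _.
  case: (w j) => [k|]; last by rewrite big1 ?mul0r.
  apply: le_trans (shifted_sum_le _ _ t0' s0).
  by rewrite [leRHS]big_ord_recl /= sub0n s0 mul0r add0r.
rewrite big_split -mulr_sumr -/(S N) /=.
case: N N0 => // N _; rewrite big_ord_recl /= expr1.
have : 0 <= \sum_(i < N) t ^+ (bump 0 i).+1.
  by apply: sumr_ge0 => n _; rewrite exprn_ge0.
have -> : S N.+2 = S N.+1 + (s N.+1)%:R * t ^+ N.+1 by rewrite /S big_ord_recr.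
move: neg; rewrite -/W.
have Y0 : 0 <= (s N.+1)%:R * t ^+ N.+1 by rewrite mulr_ge0 ?exprn_ge0.
move: (S N.+1) (S0 N.+1) (_ * t ^+ N.+1) Y0 (\sum_(i < N) _) => X X0 Y Y0 Z P Z0 H.
(* Negativity of the polynomial bounds [(1 + W)(X + Y)] by [d t (X + Y)]. The terms in [X] then
   cancel, and of the geometric sum only its first term [t] is kept. *)
have PX : (1 - d%:R * t + W) * (X + Y) <= 0.
  by rewrite mulr_le0_ge0 ?addr_ge0// ltW.
have : t <= t * (d%:R * Y) by nra.
by rewrite ler_pMr.
Qed.

(** Otherwise [c n <= q ^+ n] for large [n] and some [q < t^-1]; the partial sums are then at most
    [C * q ^+ N], and multiplied by [t ^+ N] they tend to 0. *)
Lemma growth_rate_lower_bound c t (a : R) :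
  0 < t < 1 ->
  (forall N, (0 < N)%N -> 1 <= a * ((\sum_(k < N) c k)%:R * t ^+ N)) ->
  (t^-1%:E <= limn_esup (fun n => ((c n)%:R `^ n%:R^-1 : R)%:E))%E.
Proof.
move=> /andP[t0 t1] lb; rewrite leNgt; apply/negP => lt.
have ti1 : 1 < t^-1 by rewrite invf_gt1.
have [q [q1 qt cq]] : exists q, [/\ 1 < q, q < t^-1 &
    \forall n \near \oo, (c n)%:R <= q ^+ n].
  move: lt; rewrite /limn_esup limf_esupE => /ereal_inf_lt[_ [V Voo <-] Vt].
  (* Taking [q0] at least 1 makes the midpoint [q] exceed 1, as the geometric bound on the partial
     sums requires. *)
  have [q0 [q01 q0t Vq]] : exists q0 : R, [/\ 1 <= q0, q0 < t^-1 &
      (ereal_sup [set ((c n)%:R `^ n%:R^-1 : R)%:E | n in V] <= q0%:E)%E].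
    case: (ereal_sup _) Vt => [y| |]//; last by exists 1; rewrite leNye.
    rewrite lte_fin => yt; exists (Num.max 1 y).
    by rewrite le_max lexx gt_max ti1 yt lee_fin le_max lexx orbT.
  exists ((q0 + t^-1) / 2); split; [lra|lra|].
  have Noo : \forall n \near \oo, (0 < n)%N by exists 1%N.
  apply: filterS2 Voo Noo => n Vn n0.
  have cq0 : (c n)%:R `^ n%:R^-1 <= q0.
    by rewrite -lee_fin; apply: le_trans Vq; apply: ereal_sup_ubound; exists n.
  have -> : (c n)%:R = ((c n)%:R `^ n%:R^-1) ^+ n :> R.
    by rewrite -powR_mulrn ?powR_ge0// -powRrM mulVf ?powRr1// pnatr_eq0 -lt0n.
  rewrite lerXn2r ?nnegrE ?powR_ge0//; first by lra.
  by apply: le_trans cq0 _; lra.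
have [n0 _ cn0] := cq.
have q0 : 0 < q by rewrite (lt_trans _ q1).
pose s N := (\sum_(k < N) c k)%N.
(* The first entry starts the induction at [n0]; the second gives [C * (q - 1) >= 1], which absorbs
   the new power of [q] at each step. *)
pose C : R := Num.max (s n0)%:R (q - 1)^-1.
have C0 : 0 <= C by rewrite le_max ler0n.
have sC k : (s (n0 + k)%N)%:R <= C * q ^+ (n0 + k).
  elim: k => [|k IHk].
    rewrite addn0 (le_trans (_ : _ <= C))//; first by rewrite le_max lexx.
    by rewrite ler_peMr// exprn_ege1// ltW.
  rewrite addnS /s big_ord_recr /= natrD.
  apply: le_trans (lerD IHk (cn0 _ (leq_addr _ _))) _.
  rewrite exprS mulrCA -subr_ge0.
  rewrite (_ : _ - _ = (C * (q - 1) - 1) * q ^+ (n0 + k)); last by ring.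
  rewrite mulr_ge0 ?exprn_ge0 ?(ltW q0)// subr_ge0 -ler_pdivrMr ?subr_gt0//.
  by rewrite div1r le_max lexx orbT.
have qt1 : `|q * t| < 1.
  by rewrite ger0_norm ?mulr_ge0 ?ltW// -(mulVf (lt0r_neq0 t0)) ltr_pM2r.
have a0 : 0 < a.
  rewrite ltNge; apply/negP => a0; have := lb 1%N isT; apply/negP; rewrite -ltNge.
  by rewrite (le_lt_trans _ ltr01)// mulr_le0_ge0// mulr_ge0 ?ler0n// exprn_ge0// ltW.
have aC1 : 0 < a * C + 1 by rewrite ltr_wpDl// mulr_ge0// ltW.
(* Once [(q t)^N] is below this tolerance, [a C (q t)^N < 1], against [lb]. *)
have /cvgrPdist_lt/(_ (a * C + 1)^-1) := cvg_expr qt1.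
rewrite invr_gt0 => /(_ aC1)[m _ mP].
have := mP (n0 + m.+1)%N; rewrite /= => /(_ (leq_trans (leqnSn m) (leq_addl _ _))).
have := lb (n0 + m.+1)%N; rewrite addnS => /(_ isT) le1.
have qt0 : 0 <= (q * t) ^+ (n0 + m).+1 by rewrite exprn_ge0// mulr_ge0 ?ltW.
rewrite sub0r normrN ger0_norm// -[_^-1]div1r ltr_pdivlMr// => lt1.
have := le_trans le1 (_ : _ <= a * (C * (q * t) ^+ (n0 + m).+1)); rewrite exprMn.
have -> : a * (C * (q ^+ (n0 + m).+1 * t ^+ (n0 + m).+1)) =
  a * ((C * q ^+ (n0 + m).+1) * t ^+ (n0 + m).+1) by rewrite !mulrA.
have := sC m.+1; rewrite addnS => sCm /(_ _)/wrap[].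
  by rewrite ler_pM2l// ler_wpM2r// exprn_ge0// ltW.
rewrite exprMn in lt1 qt0; nra.
Qed.

End GrowthRate.

(** If [depth] falls back on its default 0, the membership still holds, since [I^0] is the whole
    algebra. *)
Lemma depth_spec (p : nat) (F : topGroupType) (x : F) :
  if depth p x is Some k then
    ideal_exp (@aug_ideal 'F_p F) k (Omega_of 'F_p x - 1) else x = 1%g.
Proof.
rewrite /depth; case: asboolP => // _.
by case: xgetP => [k _ [] //|_].
Qed.

Theorem proposition2p4 (R : realType) (p : nat) (hp : prime p) (hodd : odd p)
    (G : topGroupType) (hG : pro_p_group p G)
    (d r : nat) (F : topGroupType) (phi : F -> G) (rel : 'I_r -> F)
    (hpres : minimal_presentation p d phi rel)
    (t0 : R) (ht0 : 0 < t0 < 1)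
    (hneg : (golod_shafarevich_poly R p d rel).[t0] < 0) :
  (t0^-1%:E <= aug_growth R p G)%E.
Proof.
have [_ _ [x xfree] phi_hom phi_surj phi_ker] := hpres.
have [[_ G_hausdorff _] _] := hG.
have {}phi_surj g : exists y, phi y = g.
  by have [y _ <-] := phi_surj g Logic.I; exists y.
have pFp : p.-nat #|'F_p| by rewrite card_Fp// pnat_id.
have le_dim n := golod_shafarevich_dim pFp xfree G_hausdorff phi_hom phi_surj
  phi_ker n (fun j => depth_spec p (rel j)).
have t0_gt0 : 0 < t0 by case/andP: ht0.
apply: (@growth_rate_lower_bound R (aug_coef p G) t0 d%:R ht0) => N.
(* [aug_coef p G] and [graded_dim 'F_p G] are convertible, so [graded_sum] is the sum in the
   goal. *)
apply: (gs_sum_lower_bound (s := graded_sum 'F_p G)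
  (w := fun j => depth p (rel j))) => //.
  by rewrite /graded_sum big_ord0.
move: hneg; rewrite /golod_shafarevich_poly !hornerE horner_sum.
congr (_ < _); congr (_ + _); apply: eq_bigr => j _.
by case: depth => [k|]; rewrite !hornerE.
Qed.
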